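(* Let $\widehat{\mathcal M}'_T=\{(u_1,u_2)\in\mathbb C^2: e^{u_1}+e^{u_2}=1\}$ and let $L\colon\widehat{\mathcal M}'_T\to\mathbb C/4\pi^2\mathbb Z$ be the function, defined up to an additive constant, constructed from spin Chern-Simons theory with gauge group $\mathbb C^\times$ on the torus as described in the context (by $\exp(L/2\pi i)=\hat\tau_0/\tau'$, where $\tau'$ is a nonzero flat section of the spin Chern-Simons line bundle over $\mathcal M_T'$). Then $L$ equals, up to an additive constant, the enhanced Rogers dilogarithm $$(u_1,u_2)\longmapsto F(u_2)+\tfrac12u_1u_2\in\mathbb C/4\pi^2\mathbb Z,$$ i.e. ''$\mathrm{Li}_2(z)+\tfrac12\log(z)\log(1-z)\bmod 4\pi^2\mathbb Z$'' with $z=e^{u_1}$, $\log z=u_1$, $\log(1-z)=u_2$. Here $F\colon\mathbb C\setminus 2\pi i\mathbb Z\to\mathbb C/4\pi^2\mathbb Z$ is the function $u_2\mapsto\mathrm{Li}_2(1-e^{u_2})$ defined by analytic continuation.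
   Context: Write $i=\sqrt{-1}$. Torus. $T=\mathbb R^2/\mathbb Z^2$ with coordinates $\theta^1,\theta^2$, oriented by $d\theta^1\wedge d\theta^2$, with the spin structure for which both coordinate loops inherit the bounding spin structure. The associated quadratic refinement of the intersection pairing is $\sigma(n_1,n_2)=n_1n_2\bmod 2$ on $H^1(T;\mathbb Z/2)$, in the standard basis. Moduli spaces. $\widehat{\mathcal M}_T=\mathbb C^2$ with coordinates $u_1,u_2$; $\mathcal M_T=(\mathbb C^\times)^2$ with coordinates $\mu_1,\mu_2$; $e\colon\widehat{\mathcal M}_T\to\mathcal M_T$, $e(u_1,u_2)=(e^{u_1},e^{u_2})$, a principal $\mathbb Z^2$-bundle. $\widehat{\mathcal M}'_T=\{e^{u_1}+e^{u_2}=1\}\subset\widehat{\mathcal M}_T$, $\mathcal M'_T=\{\mu_1+\mu_2=1\}\subset\mathcal M_T$, and $e'\colon\widehat{\mathcal M}'_T\to\mathcal M'_T$ is the restriction of $e$. Universal connection. On the trivial principal $\mathbb C^\times$-bundle $\widehat{\mathcal M}_T\times T\times\mathbb C^\times\to\widehat{\mathcal M}_T\times T$ with section $\hat t_0(u,\theta)=(u,\theta,1)$, let $\hat\eta$ be the connection with $\hat t_0^*\hat\eta=-u_1d\theta^1-u_2d\theta^2$. The action $(n_1,n_2)\cdot(u_1,u_2,\theta^1,\theta^2,\lambda)=(u_1+2\pi in_1,u_2+2\pi in_2,\theta^1,\theta^2,e^{2\pi i(n_1\theta^1+n_2\theta^2)}\lambda)$ of $\mathbb Z^2$ preserves $\hat\eta$,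 so the bundle with connection descends to $\rho\colon\mathcal Q\to\mathcal M_T\times T$ with connection $\eta$, of curvature $\Omega(\eta)$. It is flat along each $\{\mu\}\times T$. Spin Chern-Simons line bundle. $\mathcal L\to\mathcal M_T$ is the line bundle whose fiber at $\mu$ is the space of functions $f$ on the set of smooth sections $t$ of $\mathcal Q|_{\{\mu\}\times T}\to T$ satisfying $$f(t\cdot h)=(-1)^{\sigma([h])}\exp\Bigl(-\frac{i}{4\pi}\int_Tt^*\eta\wedge\frac{dh}{h}\Bigr)f(t)$$ for all smooth $h\colon T\to\mathbb C^\times$, where $[h]\in H^1(T;\mathbb Z/2)$ is the mod 2 reduction of the homotopy class of $h$. A section $t$ of $\mathcal Q$ over $U\times T$, $U\subset\mathcal M_T$ open, gives a trivialization $\tau_t$ of $\mathcal L|_U$ (the function with value $1$ at $t$), and the covariant derivative on $\mathcal L$ is determined by $\nabla\tau_t=\bigl(\frac{i}{4\pi}\int_Tt^*\eta\wedge\Omega(\eta)\bigr)\tau_t$ (integration over the fiber $T$). In the same way $\hat t_0$ gives a trivialization $\hat\tau_0$ of $e^*\mathcal L\to\widehat{\mathcal M}_T$. Let $\mathcal L'=\mathcal L|_{\mathcal M'_T}$ and let $\hat\tau_0'$ be the restriction of $\hat\tau_0$ to $\widehat{\mathcal M}'_T$. The function $L$. The bundle $\mathcal L'\to\mathcal M_T'$ is flat with trivial holonomy, so it has nonzero flat sections $\tau'$, unique up to a constant in $\mathbb C^\times$. For a choice of $\tau'$ set $\varphi=\hat\tau_0'/(e')^*\tau'\colon\widehat{\mathcal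 M}'_T\to\mathbb C^\times$ and define $L\colon\widehat{\mathcal M}'_T\to\mathbb C/4\pi^2\mathbb Z$ by $\varphi=\exp(L/2\pi i)$. Changing $\tau'$ changes $L$ by an additive constant. Dilogarithm. $\mathrm{Li}_2(z)=\sum_{n\ge1}z^n/n^2$ for $|z|<1$, continued analytically. The 1-form $-u_2\,du_2/(1-e^{-u_2})$ is meromorphic on $\mathbb C$ with simple poles in $2\pi i\mathbb Z$ and residues in $2\pi i\mathbb Z$, and $F$ is its primitive $\mathbb C\setminus2\pi i\mathbb Z\to\mathbb C/4\pi^2\mathbb Z$ equal to $\mathrm{Li}_2(1-e^{u_2})$ for $u_2$ near $0$. *)

(* Defs.v *)
(* Stdlib real numbers with Coquelicot's complex numbers [C]. *)
From Stdlib Require Import Reals ZArith Lra ClassicalEpsilon.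
From Coquelicot Require Export Coquelicot.
Local Open Scope C_scope.

(** [R] is meant to be an equivalence relation. *)
Definition quot {X : Type} (R : X -> X -> Prop) : Type :=
  { P : X -> Prop | exists x, P = R x }.

Definition cls {X : Type} (R : X -> X -> Prop) (x : X) : quot R :=
  exist _ (R x) (ex_intro _ x eq_refl).

Definition repr {X : Type} {R : X -> X -> Prop} (q : quot R) : X :=
  proj1_sig (constructive_indefinite_description _ (proj2_sig q)).

Definition Cexp (z : C) : C :=
  (exp (fst z) * cos (snd z), exp (fst z) * sin (snd z))%R.

Lemma Cexp_neq_0 (z : C) : Cexp z <> 0.
Proof.
  intro H. injection H as Hc Hs.
  pose proof (exp_pos (fst z)) as He.
  pose proof (sin2_cos2 (snd z)) as H1. unfold Rsqr in H1.
  apply Rmult_integral in Hc. apply Rmult_integral in Hs.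
  destruct Hc as [Hc|Hc]; [lra|]. destruct Hs as [Hs|Hs]; [lra|].
  rewrite Hc, Hs in H1. lra.
Qed.

Record Cstar : Type := mkCstar { cval :> C; cval_neq_0 : cval <> 0 }.

Definition Cstar_exp (z : C) : Cstar := mkCstar (Cexp z) (Cexp_neq_0 z).

Definition Cstar_one : Cstar := Cstar_exp 0.

Definition Cstar_mul (a b : Cstar) : Cstar :=
  mkCstar (cval a * cval b)
          (Cmult_neq_0 _ _ (cval_neq_0 a) (cval_neq_0 b)).

Definition four_pi2_rel (z w : C) : Prop :=
  exists k : Z, w = z + RtoC (4 * PI * PI * IZR k)%R.

Definition C4pi2 : Type := quot four_pi2_rel.

Definition to_C4pi2 (z : C) : C4pi2 := cls four_pi2_rel z.

Definition add4 (a b : C4pi2) : C4pi2 := to_C4pi2 (repr a + repr b).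

(** [exp (l / (2 pi i))], well defined on [C / 4 pi^2 Z] *)
Definition exp_over_2pii (l : C4pi2) : C :=
  Cexp (repr l / (RtoC (2 * PI) * Ci)).

(** [dirD f x v] is the derivative of [f] at [x] in the (real) direction [v];
   a form is evaluated at a point and then on tangent vectors. *)

Definition ex_dirD {E : NormedModule R_AbsRing} (f : E -> C) (x v : E) : Prop :=
  ex_derive (fun s : R => fst (f (plus x (scal s v)))) 0%R /\
  ex_derive (fun s : R => snd (f (plus x (scal s v)))) 0%R.

Definition dirD {E : NormedModule R_AbsRing} (f : E -> C) (x v : E) : C :=
  (Derive (fun s : R => fst (f (plus x (scal s v)))) 0%R,
   Derive (fun s : R => snd (f (plus x (scal s v)))) 0%R).

(** For [E] finite dimensional and [D] open, this is the usual class [C^k]. *)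
Fixpoint Ck_on {E : NormedModule R_AbsRing} (k : nat) (D : E -> Prop)
    (f : E -> C) : Prop :=
  (forall x, D x -> continuous f x) /\
  match k with
  | O => True
  | S k' => forall v : E,
      (forall x, D x -> ex_dirD f x v) /\ Ck_on k' D (fun x => dirD f x v)
  end.

Definition smooth_on {E : NormedModule R_AbsRing} (D : E -> Prop)
    (f : E -> C) : Prop := forall k, Ck_on k D f.

Definition form1 (E : NormedModule R_AbsRing) : Type := E -> E -> C.
Definition form2 (E : NormedModule R_AbsRing) : Type := E -> E -> E -> C.
Definition form3 (E : NormedModule R_AbsRing) : Type := E -> E -> E -> E -> C.

Definition ext_d {E : NormedModule R_AbsRing} (a : form1 E) : form2 E :=
  fun x v w => dirD (fun y => a y w) x v - dirD (fun y => a y v) x w.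

Definition wedge11 {E : NormedModule R_AbsRing} (a b : form1 E) : form2 E :=
  fun x v w => a x v * b x w - a x w * b x v.

Definition wedge12 {E : NormedModule R_AbsRing} (a : form1 E) (b : form2 E)
  : form3 E :=
  fun x v1 v2 v3 =>
    a x v1 * b x v2 v3 - a x v2 * b x v1 v3 + a x v3 * b x v1 v2.

Definition dlog {E : NormedModule R_AbsRing} (h : E -> C) : form1 E :=
  fun x v => dirD h x v / h x.

Definition VC : NormedModule R_AbsRing := C_R_NormedModule.
Definition VR2 : NormedModule R_AbsRing :=
  prod_NormedModule R_AbsRing R_NormedModule R_NormedModule.
Definition VC2 : NormedModule R_AbsRing := prod_NormedModule R_AbsRing VC VC.
Definition VC2R2 : NormedModule R_AbsRing := prod_NormedModule R_AbsRing VC2 VR2.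

Definition torus_rel (x y : R * R) : Prop :=
  exists m1 m2 : Z, y = (fst x + IZR m1, snd x + IZR m2)%R.

Definition torus : Type := quot torus_rel.

Definition pt (x : R * R) : torus := cls torus_rel x.

Definition d_theta1 : VR2 := (1%R, 0%R).
Definition d_theta2 : VR2 := (0%R, 1%R).

Definition torus_int (f : VR2 -> C) : C :=
  RInt (V := C_R_CompleteNormedModule)
    (fun x => RInt (V := C_R_CompleteNormedModule) (fun y => f (x, y)) 0 1) 0 1.

(** Integral of a 2-form on [T], with [T] oriented by [dtheta1 /\ dtheta2] *)
Definition torus_int2 (w : form2 VR2) : C :=
  torus_int (fun x => w x d_theta1 d_theta2).

Definition smooth_torus_map (h : torus -> Cstar) : Prop :=
  smooth_on (E := VR2) (fun _ => True) (fun x => cval (h (pt x))).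

(** The map [exp (2 pi i (n1 theta1 + n2 theta2))], of homotopy class
    [(n1, n2)] in [H^1(T; Z) = Z^2] *)
Definition chi (n : Z * Z) (theta : torus) : Cstar :=
  let x := repr theta in
  Cstar_exp (RtoC (2 * PI) * Ci *
    RtoC (IZR (fst n) * fst x + IZR (snd n) * snd x)).

(** Homotopies are parametrized by [R]: one on [[0, 1]] extends by constants. *)
Definition homotopy_class (h : torus -> Cstar) (n : Z * Z) : Prop :=
  exists H : R -> torus -> Cstar,
    (forall p : R * (R * R),
       continuous (fun q : R * (R * R) => cval (H (fst q) (pt (snd q))) : VC) p)
    /\ (forall theta, H 0%R theta = h theta)
    /\ (forall theta, H 1%R theta = chi n theta).

Definition mod2 (n : Z * Z) : bool * bool := (Z.odd (fst n), Z.odd (snd n)).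

(** The quadratic refinement [n1 n2] on [H^1(T; Z/2)] *)
Definition sigma (a : bool * bool) : bool := andb (fst a) (snd a).

Definition sign (b : bool) : C := if b then - (1) else 1.

Definition MT : Type := (Cstar * Cstar)%type.

Definition e_map (u : C * C) : MT := (Cstar_exp (fst u), Cstar_exp (snd u)).

Definition MT' (mu : MT) : Prop := cval (fst mu) + cval (snd mu) = 1.

Definition Mhat' (u : C * C) : Prop := Cexp (fst u) + Cexp (snd u) = 1.

Definition open_MT (U : MT -> Prop) : Prop :=
  forall mu, U mu -> exists eps : posreal, forall nu : MT,
    (Cmod (cval (fst nu) - cval (fst mu)) < eps)%R ->
    (Cmod (cval (snd nu) - cval (snd mu)) < eps)%R -> U nu.

Definition deck (n : Z * Z) (u : C * C) : C * C :=
  (fst u + RtoC (2 * PI) * Ci * RtoC (IZR (fst n)),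
   snd u + RtoC (2 * PI) * Ci * RtoC (IZR (snd n))).

Definition Qhat : Type := ((C * C) * torus * Cstar)%type.

Definition Q_rel (p q : Qhat) : Prop :=
  let '(u, theta, lambda) := p in
  exists n : Z * Z, q = (deck n u, theta, Cstar_mul (chi n theta) lambda).

Definition Q : Type := quot Q_rel.

Definition Qpt (u : C * C) (theta : torus) (lambda : Cstar) : Q :=
  cls Q_rel (u, theta, lambda).

Definition Q_act (q : Q) (z : Cstar) : Q :=
  let '(u, theta, lambda) := repr q in Qpt u theta (Cstar_mul lambda z).

(** The section [t0hat]: over [u] it gives a section of [Q] over
    [{e(u)} x T]. *)
Definition t0hat (u : C * C) (theta : torus) : Q := Qpt u theta Cstar_one.

(** The connection form on [Qhat], lifted to [C^2 x R^2 x C^x], at the point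
    [(x, lambda)] on the tangent vector [(v, lambdadot)]: it is
    [dlambda / lambda] on the fibers and pulls back along [lambda = 1] to
    [- u1 dtheta1 - u2 dtheta2]. *)
Definition eta_hat (x : VC2R2) (lambda : C) (v : VC2R2) (lambdadot : C) : C :=
  let u := fst x in let thetadot := snd v in
  - fst u * RtoC (fst thetadot) - snd u * RtoC (snd thetadot)
  + lambdadot / lambda.

(** A section [t] of [Q] over [U x T] is described on the covering
    [e^{-1}(U) x R^2] by the function [lam] with
    [t (e u, [x]) = [u, [x], lam (u, x)]], and [pull_eta lam] is [t^* eta]
    pulled back to that covering. *)
Definition pull_eta (lam : VC2R2 -> Cstar) : form1 VC2R2 :=
  fun x v => eta_hat x (lam x) v (dirD (fun y => cval (lam y)) x v).

(** The curvature [d eta], as a form on the base pulled back to [C^2 x R^2] *)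
Definition Omega : form2 VC2R2 := ext_d (pull_eta (fun _ => Cstar_one)).

Definition smooth_section_over (U : MT -> Prop) (t : MT -> torus -> Q)
    (lam : VC2R2 -> Cstar) : Prop :=
  (forall (u : C * C) (x : R * R), U (e_map u) ->
     t (e_map u) (pt x) = Qpt u (pt x) (lam (u, x))) /\
  smooth_on (fun y : VC2R2 => U (e_map (fst y))) (fun y => cval (lam y)).

(** The same over [{mu} x T], through a point [u] over [mu]; neither the
    smoothness of [t] nor [t^* eta] depends on [u]. *)
Definition fiber_section (mu : MT) (t : torus -> Q) (u : C * C)
    (lam : VR2 -> Cstar) : Prop :=
  e_map u = mu /\
  (forall x : R * R, t (pt x) = Qpt u (pt x) (lam x)) /\
  smooth_on (fun _ => True) (fun x => cval (lam x)).

Definition is_smooth_section (mu : MT) (t : torus -> Q) : Prop :=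
  exists u lam, fiber_section mu t u lam.

Definition fiber_pull_eta (u : C * C) (lam : VR2 -> Cstar) : form1 VR2 :=
  fun x v => eta_hat (u, x) (lam x) (zero, v) (dirD (fun y => cval (lam y)) x v).

(** The fiber of the spin Chern-Simons line bundle at [mu] is a space of functions on the smooth sections of [Q]
   over [{mu} x T]; such a function is extended by [0] to all maps [T -> Q]. *)

Definition pre_fiber : Type := (torus -> Q) -> C.

Definition CS_fiber (mu : MT) (f : pre_fiber) : Prop :=
  (forall t, ~ is_smooth_section mu t -> f t = 0) /\
  (forall t u lam h n,
     fiber_section mu t u lam -> smooth_torus_map h -> homotopy_class h n ->
     f (fun theta => Q_act (t theta) (h theta)) =
       sign (sigma (mod2 n)) *
       Cexp (- (Ci / RtoC (4 * PI)) *
             torus_int2 (wedge11 (fiber_pull_eta u lam)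
                                 (dlog (fun x => cval (h (pt x)))))) *
       f t).

(** [f] is the element of the fiber at [mu] with value [1] at [t]. *)
Definition triv_at (mu : MT) (t : torus -> Q) (f : pre_fiber) : Prop :=
  CS_fiber mu f /\ f t = 1.

(** The connection form [(i / 4 pi) int_T t^* eta /\ Omega] of the
    trivialization [tau_t], at [e(u)] on the image of [udot] under the
    differential of [e] *)
Definition CS_conn (lam : VC2R2 -> Cstar) (u udot : VC2) : C :=
  Ci / RtoC (4 * PI) *
  torus_int (fun x =>
    wedge12 (pull_eta lam) Omega ((u, x) : VC2R2)
      ((udot, zero) : VC2R2) ((zero, d_theta1) : VC2R2)
      ((zero, d_theta2) : VC2R2)).

(** Flat sections of the restriction of the bundle to [MT'].  [MT'] has the
    global coordinate [z = mu1], with tangent vectors [(a, -a)] for [a] in [C].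
    Writing [tau' = g(z) tau_t] over the part of [MT'] in [U],
    [nabla tau' = (dg + g A_t) tau_t] with [A_t] given by [CS_conn]. *)
Definition flat_section (tau' : MT -> pre_fiber) : Prop :=
  (forall mu, MT' mu -> CS_fiber mu (tau' mu)) /\
  (forall (U : MT -> Prop) (t : MT -> torus -> Q) (lam : VC2R2 -> Cstar)
          (tau_t : MT -> pre_fiber) (g : C -> C),
     open_MT U -> smooth_section_over U t lam ->
     (forall mu, U mu -> triv_at mu (t mu) (tau_t mu)) ->
     (forall mu s, U mu -> MT' mu -> tau' mu s = g (cval (fst mu)) * tau_t mu s) ->
     smooth_on (E := VC)
       (fun z => exists mu : MT, U mu /\ MT' mu /\ cval (fst mu) = z) g /\
     (forall (u udot : C * C) (a : C),
        U (e_map u) -> MT' (e_map u) ->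
        Cexp (fst u) * fst udot = a -> Cexp (snd u) * snd udot = - a ->
        dirD (E := VC) g (Cexp (fst u)) a + g (Cexp (fst u)) * CS_conn lam u udot
        = 0)).

Definition nonzero_section (tau' : MT -> pre_fiber) : Prop :=
  exists mu t, MT' mu /\ tau' mu t <> 0.

(** [L] is a function [Mhat' -> C / 4 pi^2 Z] obtained from some choice of
    nonzero flat section [tau'] (values of [L] outside [Mhat'] are
    irrelevant). *)
Definition CS_function (L : C * C -> C4pi2) : Prop :=
  exists (tau0hat : C * C -> pre_fiber) (tau' : MT -> pre_fiber)
         (phi : C * C -> C),
    (forall u, triv_at (e_map u) (t0hat u) (tau0hat u)) /\
    flat_section tau' /\ nonzero_section tau' /\
    (forall u t, Mhat' u -> tau0hat u t = phi u * tau' (e_map u) t) /\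
    (forall u, Mhat' u -> phi u = exp_over_2pii (L u)).

Definition Li2 (z : C) : C :=
  let a := fun n : nat => z ^ S n / RtoC (INR (S n) ^ 2)%R in
  (Series (fun n => fst (a n)), Series (fun n => snd (a n))).

(** The function [F], defined off [2 pi i Z] (its values there are
    irrelevant) *)
Definition dilog_continuation (F : C -> C4pi2) : Prop :=
  (forall w : C, (forall k : Z, w <> RtoC (2 * PI * IZR k)%R * Ci) ->
     exists f : C -> C, locally w (fun w' =>
       F w' = to_C4pi2 (f w') /\
       is_derive f w' (- w' / (1 - Cexp (- w'))))) /\
  locally' (0 : C) (fun w => F w = to_C4pi2 (Li2 (1 - Cexp w))).

(* Main.v *)
(** In logarithmic coordinates [(u1, u2)] near a point of the curve
    [e^{u1} + e^{u2} = 1], the connection form of the trivialization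
    [tau0hat] is [(i / 4 pi) (u2 du1 - u1 du2)].  On the curve
    [d Li2(1 - e^{u2}) = - u2 du1], so [exp ((F(u2) + u1 u2 / 2) / (2 pi i))]
    satisfies the same first order equation as [phi = tau0hat / tau'], and the
    quotient of the two is locally constant.  The curve is connected: every
    point can be moved to [u2 = -1], and there the sheets, which differ by
    [2 pi i Z] in [u1], are joined through the half plane [Re u1 < 0], on which
    [u2] is a function of [e^{u1}].  Hence the quotient is constant, and taking
    logarithms costs only the kernel [4 pi^2 Z]. *)
Require Import Defs.
From Stdlib Require Import Reals Lra Lia ZArith ClassicalEpsilon.
From Stdlib Require Import FunctionalExtensionality PropExtensionality ProofIrrelevance.
From Coquelicot Require Import Coquelicot.
Local Open Scope C_scope.

(** * Exponential, logarithm and curves in C *)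

(** Flatness of [tau'] is expressed only against sections of [Q] over open subsets of [MT], while
    [t0hat] lives on the cover. Near [e_map u0] a branch of the logarithm brings [t0hat] down to
    such a section. On the cover that section is described by a character [chi n], where [n] records
    the sheet; on the sheet of the branch itself [n = 0], which is why the connection form there is
    the simple one. The curve is parametrized near each point by [z = Cexp u1], and equations are
    differentiated along real segments in [z].

    For connectedness, [u1] has to follow [log (1 - e^{u2})] while the logarithm is available on a
    half plane only. A path of [u2] is therefore admissible when [1 - e^{u2}] stays in one open half
    plane, which may be any rotation of the right one. This holds on all of [Re u2 < 0] and along
    each horizontal line off [Im u2] in [2 pi Z]. The rays [Re u2 > 0], [Im u2] in [2 pi Z] are
    left, and a slanted path leads off them.

    Representatives in [C / 4 pi^2 Z] are chosen without continuity, so only exponentials of them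
    are compared until the very end. *)

Lemma Cexp_0 : Cexp 0 = 1.
Proof.
  unfold Cexp; simpl. rewrite exp_0, cos_0, sin_0.
  apply injective_projections; simpl; ring.
Qed.

Lemma Cexp_plus (a b : C) : Cexp (a + b) = Cexp a * Cexp b.
Proof.
  unfold Cexp; destruct a as [a1 a2], b as [b1 b2]; simpl.
  rewrite exp_plus, cos_plus, sin_plus.
  apply injective_projections; simpl; ring.
Qed.

Lemma Cexp_opp (a : C) : Cexp (- a) = / Cexp a.
Proof.
  assert (H : Cexp (- a) * Cexp a = 1).
  { rewrite <- Cexp_plus. replace (- a + a) with (0 : C) by ring. apply Cexp_0. }
  pose proof (Cexp_neq_0 a).
  rewrite <- (Cmult_1_l (/ Cexp a)), <- H. field. assumption.
Qed.

Lemma Cexp_minus (a b : C) : Cexp (a - b) = Cexp a / Cexp b.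
Proof. unfold Cminus. rewrite Cexp_plus, Cexp_opp. reflexivity. Qed.

Lemma Cexp_eq_1 (z : C) :
  Cexp z = 1 <-> exists k : Z, z = RtoC (2 * PI) * Ci * RtoC (IZR k).
Proof.
  split.
  - destruct z as [x y]. unfold Cexp. intro H. injection H as Hc Hs. simpl in *.
    pose proof (exp_pos x) as He. pose proof (sin2_cos2 y) as H1. unfold Rsqr in H1.
    assert (Hsy : sin y = 0%R) by nra.
    assert (Hcy : cos y = 1%R) by nra.
    rewrite Hcy, Rmult_1_r, <- exp_0 in Hc. apply exp_inv in Hc. subst x.
    (* Halving the angle turns [cos y = 1] into the vanishing of a sine, whose zeros [k PI] give the
       period [2 PI] for [y]. *)
    assert (Hh : sin (y / 2) = 0%R).
    { replace y with (2 * (y / 2))%R in Hcy by field.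
      rewrite cos_2a_sin in Hcy. nra. }
    destruct (sin_eq_0_0 _ Hh) as [k Hk]. exists k.
    apply injective_projections; simpl; lra.
  - intros [k ->].
    assert (Hs : sin (IZR k * PI) = 0%R) by (apply sin_eq_0_1; now exists k).
    unfold Cexp; simpl.
    match goal with |- (exp ?a * cos ?b, _)%R = _ =>
      replace a with 0%R by ring; replace b with (2 * (IZR k * PI))%R by ring end.
    rewrite exp_0, cos_2a_sin, sin_2a, Hs.
    apply injective_projections; simpl; ring.
Qed.

Lemma cos_minus_2kPI (y : R) (k : Z) : cos (y - 2 * PI * IZR k) = cos y.
Proof.
  assert (Hs : sin (IZR k * PI) = 0%R) by (apply sin_eq_0_1; now exists k).
  replace (2 * PI * IZR k)%R with (2 * (IZR k * PI))%R by ring.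
  rewrite cos_minus, cos_2a_sin, sin_2a, Hs. ring.
Qed.

(** The principal branch of the logarithm, on the right half plane only. *)
Definition Clog (z : C) : C :=
  (ln (fst z * fst z + snd z * snd z) / 2, atan (snd z * / fst z))%R.

Lemma Cexp_Clog (z : C) : (0 < fst z)%R -> Cexp (Clog z) = z.
Proof.
  destruct z as [x y]; simpl; intro Hx. unfold Cexp, Clog; simpl.
  set (r2 := (x * x + y * y)%R). assert (Hr : (0 < r2)%R) by (unfold r2; nra).
  assert (He : exp (ln r2 / 2) = sqrt r2).
  { rewrite <- (sqrt_square (exp (ln r2 / 2))) by (left; apply exp_pos).
    f_equal. rewrite <- exp_plus. replace (ln r2 / 2 + ln r2 / 2)%R with (ln r2) by field.
    now apply exp_ln. }
  assert (Hq : sqrt (1 + Rsqr (y * / x)) = (sqrt r2 / x)%R).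
  { rewrite <- (sqrt_square x) at 2 by lra.
    rewrite <- sqrt_div_alt by nra. f_equal. unfold r2, Rsqr. field. lra. }
  assert (Hs : (0 < sqrt r2)%R) by now apply sqrt_lt_R0.
  rewrite He, cos_atan, sin_atan, Hq.
  apply injective_projections; simpl; field; split; lra.
Qed.

(** Both sides are logarithms of the same number, and both imaginary parts lie in one open interval
    of length [PI], which leaves no room for a nonzero multiple of [2 PI]. *)
Lemma Clog_Cexp (w : C) : (- (PI / 2) < snd w < PI / 2)%R -> Clog (Cexp w) = w.
Proof.
  intro Hw.
  assert (Hp : (0 < fst (Cexp w))%R).
  { unfold Cexp; simpl. apply Rmult_lt_0_compat; [apply exp_pos|apply cos_gt_0; lra]. }
  pose proof (Cexp_Clog _ Hp) as H.
  assert (H1 : Cexp (Clog (Cexp w) - w) = 1).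
  { rewrite Cexp_minus, H. field. apply Cexp_neq_0. }
  apply Cexp_eq_1 in H1. destruct H1 as [k Hk].
  pose proof (atan_bound (snd (Cexp w) * / fst (Cexp w))) as Hb.
  assert (Hs : (snd (Clog (Cexp w)) - snd w = 2 * PI * IZR k)%R).
  { apply (f_equal snd) in Hk. simpl in Hk. simpl. lra. }
  change (snd (Clog (Cexp w))) with (atan (snd (Cexp w) * / fst (Cexp w))) in Hs.
  pose proof PI_RGT_0.
  assert (Hk0 : k = 0%Z).
  { assert (-1 < IZR k)%R by nra. assert (IZR k < 1)%R by nra.
    apply lt_IZR in H1. apply lt_IZR in H2. lia. }
  subst k. replace (Clog (Cexp w)) with (w + (Clog (Cexp w) - w)) by ring.
  rewrite Hk. simpl. ring.
Qed.

(** Componentwise because [dirD] is: facts pass between the two directly, and products, [Cexp] and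
    [Clog] reduce to real calculus. *)
Definition cder (f : R -> C) (s : R) (l : C) : Prop :=
  is_derive (fun t => fst (f t)) s (fst l) /\ is_derive (fun t => snd (f t)) s (snd l).

Lemma cder_eq (f : R -> C) s l l' : cder f s l -> l = l' -> cder f s l'.
Proof. now intros H <-. Qed.

Lemma cder_ext_loc (f g : R -> C) s l :
  locally s (fun t => f t = g t) -> cder f s l -> cder g s l.
Proof.
  intros H [H1 H2]; split.
  - apply (is_derive_ext_loc (fun t => fst (f t))); trivial.
    revert H; apply filter_imp; now intros t ->.
  - apply (is_derive_ext_loc (fun t => snd (f t))); trivial.
    revert H; apply filter_imp; now intros t ->.
Qed.

Lemma cder_ext (f g : R -> C) s l :
  (forall t, f t = g t) -> cder f s l -> cder g s l.
Proof. intro H. apply cder_ext_loc. now apply filter_forall. Qed.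

Lemma cder_const (c : C) s : cder (fun _ => c) s 0.
Proof. split; apply (is_derive_const (K := R_AbsRing) (V := R_NormedModule)). Qed.

Lemma cder_plus (f g : R -> C) s a b :
  cder f s a -> cder g s b -> cder (fun t => f t + g t) s (a + b).
Proof.
  intros [H1 H2] [H3 H4]; split; simpl.
  - exact (is_derive_plus (V := R_NormedModule) _ _ _ _ _ H1 H3).
  - exact (is_derive_plus (V := R_NormedModule) _ _ _ _ _ H2 H4).
Qed.

Lemma is_derive_mult_R (f g : R -> R) s a b :
  is_derive f s a -> is_derive g s b ->
  is_derive (fun t => f t * g t)%R s (a * g s + f s * b)%R.
Proof.
  intros H1 H2. apply (is_derive_mult (K := R_AbsRing) f g s a b); trivial.
  intros; apply Rmult_comm.
Qed.

Lemma cder_mult (f g : R -> C) s a b :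
  cder f s a -> cder g s b -> cder (fun t => f t * g t) s (a * g s + f s * b).
Proof.
  intros [H1 H2] [H3 H4]; split; simpl.
  - eapply (eq_rect _ (fun l => is_derive _ s l)).
    + exact (is_derive_minus (V := R_NormedModule) _ _ _ _ _
        (is_derive_mult_R _ _ _ _ _ H1 H3) (is_derive_mult_R _ _ _ _ _ H2 H4)).
    + unfold minus, plus, opp; simpl. ring.
  - eapply (eq_rect _ (fun l => is_derive _ s l)).
    + exact (is_derive_plus (V := R_NormedModule) _ _ _ _ _
        (is_derive_mult_R _ _ _ _ _ H1 H4) (is_derive_mult_R _ _ _ _ _ H2 H3)).
    + unfold plus; simpl. ring.
Qed.

Lemma cder_RtoC s : cder RtoC s 1.
Proof.
  split; simpl.
  - exact (is_derive_id (K := R_AbsRing) s).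
  - exact (is_derive_const (K := R_AbsRing) (V := R_NormedModule) 0%R s).
Qed.

Lemma cder_scal (c : C) (f : R -> C) s a :
  cder f s a -> cder (fun t => c * f t) s (c * a).
Proof.
  intro H. eapply cder_eq; [apply cder_mult; [apply cder_const|exact H]|]. simpl. ring.
Qed.

Lemma cder_line (z v : C) s : cder (fun t => z + RtoC t * v) s v.
Proof.
  eapply cder_eq.
  - apply cder_plus; [apply cder_const|].
    apply cder_mult; [apply cder_RtoC|apply cder_const].
  - cbv beta. ring.
Qed.

Lemma cder_shift (f : R -> C) s t l :
  cder f (t - s) l -> cder (fun r => f (r - s)%R) t l.
Proof.
  assert (Hs : is_derive (fun r : R => r - s)%R t 1%R) by (auto_derive; trivial; ring).
  intros [H1 H2]; split.
  - eapply (eq_rect _ (fun l => is_derive _ t l)).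
    + exact (is_derive_comp (fun r => fst (f r)) (fun r => r - s)%R t _ _ H1 Hs).
    + unfold scal; simpl; unfold mult; simpl; ring.
  - eapply (eq_rect _ (fun l => is_derive _ t l)).
    + exact (is_derive_comp (fun r => snd (f r)) (fun r => r - s)%R t _ _ H2 Hs).
    + unfold scal; simpl; unfold mult; simpl; ring.
Qed.

Lemma cder_Cexp (f : R -> C) s a :
  cder f s a -> cder (fun t => Cexp (f t)) s (Cexp (f s) * a).
Proof.
  intros [H1 H2].
  assert (HE := is_derive_comp exp (fun t => fst (f t)) s _ _ (is_derive_exp _) H1).
  assert (HC := is_derive_comp cos (fun t => snd (f t)) s _ _ (is_derive_cos _) H2).
  assert (HS := is_derive_comp sin (fun t => snd (f t)) s _ _ (is_derive_sin _) H2).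
  split; simpl.
  - eapply (eq_rect _ (fun l => is_derive _ s l)).
    + exact (is_derive_mult_R _ _ _ _ _ HE HC).
    + unfold scal; simpl; unfold mult; simpl. ring.
  - eapply (eq_rect _ (fun l => is_derive _ s l)).
    + exact (is_derive_mult_R _ _ _ _ _ HE HS).
    + unfold scal; simpl; unfold mult; simpl. ring.
Qed.

Lemma cder_Clog (f : R -> C) s a :
  (0 < fst (f s))%R -> cder f s a -> cder (fun t => Clog (f t)) s (a / f s).
Proof.
  intros Hp [H1 H2].
  set (x := fun t => fst (f t)) in *. set (y := fun t => snd (f t)) in *.
  assert (Hx : (0 < x s)%R) by exact Hp.
  assert (E1 := is_derive_unique (x : R -> R) s _ H1).
  assert (E2 := is_derive_unique (y : R -> R) s _ H2).
  assert (D1 : ex_derive x s) by (eexists; exact H1).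
  assert (D2 : ex_derive y s) by (eexists; exact H2).
  assert (Hn : (0 < x s * x s + y s * y s)%R) by nra.
  split.
  - apply (is_derive_ext (fun t => ln (x t * x t + y t * y t) / 2)%R);
      [intro; reflexivity|].
    auto_derive; [repeat split; trivial; nra|].
    change (fun t => x t) with x; change (fun t => y t) with y.
    rewrite E1, E2. unfold Cdiv, Cmult, Cinv; simpl.
    fold (x s) (y s). field. lra.
  - apply (is_derive_ext (fun t => atan (y t * / x t))%R); [intro; reflexivity|].
    auto_derive; [repeat split; trivial; lra|].
    change (fun t => x t) with x; change (fun t => y t) with y.
    rewrite E1, E2. unfold Cdiv, Cmult, Cinv; simpl.
    fold (x s) (y s). field. repeat split; nra.
Qed.

Lemma is_derive_C_R (f : R -> C) s l :
  cder f s l -> is_derive (K := R_AbsRing) (V := C_R_NormedModule) f s l.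
Proof.
  intros [H1 H2].
  apply (is_derive_ext (V := C_R_NormedModule)
    (fun t => plus (scal (fst (f t)) ((1, 0)%R : C_R_NormedModule))
                   (scal (snd (f t)) ((0, 1)%R : C_R_NormedModule)))).
  { intro t. apply injective_projections; unfold plus, scal; simpl;
      unfold plus, scal, mult; simpl; unfold mult; simpl; ring. }
  eapply (eq_rect _ (fun l => is_derive _ s l)).
  - apply (is_derive_plus (V := C_R_NormedModule)).
    + exact (is_derive_scal_l (V := C_R_NormedModule) _ _ _ _ H1).
    + exact (is_derive_scal_l (V := C_R_NormedModule) _ _ _ _ H2).
  - apply injective_projections; unfold plus, scal; simpl;
      unfold plus, scal, mult; simpl; unfold mult; simpl; ring.
Qed.

Lemma norm_C_R (z : C) : norm (V := C_R_NormedModule) z = Cmod z.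
Proof.
  change (sqrt (Rabs (fst z) ^ 2 + Rabs (snd z) ^ 2) = sqrt (fst z ^ 2 + snd z ^ 2))%R.
  now rewrite !pow2_abs.
Qed.

(** The curve is differentiable over [R] and [F] over [C]. For a chain rule over one field, the
    complex derivative is reread as the real-linear map [y -> y * l]; the error estimate carries
    over because both norms are [Cmod] and the neighborhoods agree. *)
Lemma cder_holo (F : C -> C) (f : R -> C) s l a :
  is_derive (K := C_AbsRing) (V := C_NormedModule) F (f s) l -> cder f s a ->
  cder (fun t => F (f t)) s (a * l).
Proof.
  intros [_ HF] Hf.
  assert (HR : filterdiff (K := R_AbsRing) (U := C_R_NormedModule) (V := C_R_NormedModule)
                 F (locally (f s)) (fun y : C => y * l)).
  { split.
    - split.
      + intros x y. unfold plus; simpl. apply injective_projections; simpl; unfold plus; simpl; ring.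
      + intros k x. unfold scal; simpl. apply injective_projections; simpl;
          unfold scal; simpl; unfold mult; simpl; ring.
      (* The [+ 1] keeps the operator bound positive when [l = 0]. *)
      + exists (Cmod l + 1)%R. split; [pose proof (Cmod_ge_0 l); lra|].
        intro x.
        rewrite !norm_C_R, Cmod_mult. pose proof (Cmod_ge_0 x). nra.
    - intros x Hx eps.
      assert (E := is_filter_lim_locally_unique (V := C_R_NormedModule) _ _ Hx). subst x.
      specialize (HF (f s) (fun P HP => HP) eps).
      apply locally_C in HF. revert HF. apply filter_imp. intros y Hy.
      rewrite !norm_C_R. exact Hy. }
  assert (H := filterdiff_comp' (K := R_AbsRing) (U := R_NormedModule)
     (V := C_R_NormedModule) (W := C_R_NormedModule) f F s _ _ (is_derive_C_R _ _ _ Hf) HR).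
  split.
  - assert (H1 := filterdiff_comp' (K := R_AbsRing) (U := R_NormedModule)
       (V := C_R_NormedModule) (W := R_NormedModule) _ (fst : C -> R) s _ _ H
       (filterdiff_linear _ (is_linear_fst (U := R_NormedModule) (V := R_NormedModule)))).
    eapply filterdiff_ext_lin; [exact H1|].
    intro y. simpl. unfold scal; simpl. unfold scal; simpl. unfold mult; simpl. ring.
  - assert (H1 := filterdiff_comp' (K := R_AbsRing) (U := R_NormedModule)
       (V := C_R_NormedModule) (W := R_NormedModule) _ (snd : C -> R) s _ _ H
       (filterdiff_linear _ (is_linear_snd (U := R_NormedModule) (V := R_NormedModule)))).
    eapply filterdiff_ext_lin; [exact H1|].
    intro y. simpl. unfold scal; simpl. unfold scal; simpl. unfold mult; simpl. ring.
Qed.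

Lemma cder_zero_const (f : R -> C) :
  (forall s, (0 <= s <= 1)%R -> cder f s 0) -> f 1%R = f 0%R.
Proof.
  intro H. apply injective_projections.
  - symmetry. apply (eq_is_derive (V := R_NormedModule) (fun t => fst (f t))); [|lra].
    intros t Ht. exact (proj1 (H t Ht)).
  - symmetry. apply (eq_is_derive (V := R_NormedModule) (fun t => snd (f t))); [|lra].
    intros t Ht. exact (proj2 (H t Ht)).
Qed.

(** * Connectedness of the curve [e^{u1} + e^{u2} = 1] *)

Definition C2_US : UniformSpace := prod_UniformSpace C_UniformSpace C_UniformSpace.

Definition loc_const (K : C * C -> C) : Prop :=
  forall u, Mhat' u -> locally (T := C2_US) u (fun u' => Mhat' u' -> K u' = K u).

Lemma Mhat'_sub (u1 u2 : C) : Mhat' (u1, u2) -> 1 - Cexp u2 = Cexp u1.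
Proof. unfold Mhat'; simpl. intro H. rewrite <- H. ring. Qed.

Lemma cder_ball (f : R -> C) s a (eps : posreal) :
  cder f s a -> locally s (fun t => ball (M := C_UniformSpace) (f s) eps (f t)).
Proof.
  intros [H1 H2].
  assert (C1 : continuous (fun t => fst (f t)) s)
    by (apply (ex_derive_continuous (V := R_NormedModule)); eexists; exact H1).
  assert (C2 : continuous (fun t => snd (f t)) s)
    by (apply (ex_derive_continuous (V := R_NormedModule)); eexists; exact H2).
  assert (L1 := C1 _ (locally_ball (fst (f s)) eps)).
  assert (L2 := C2 _ (locally_ball (snd (f s)) eps)).
  unfold filtermap in L1, L2.
  generalize (filter_and _ _ L1 L2). apply filter_imp. intros t [A B]. split; assumption.
Qed.

Lemma cder_fst_pos (f : R -> C) s a :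
  cder f s a -> (0 < fst (f s))%R -> locally s (fun t => 0 < fst (f t))%R.
Proof.
  intros H Hp. generalize (cder_ball f s a (mkposreal _ Hp) H).
  apply filter_imp. intros t [A _].
  change (Rabs (fst (f t) - fst (f s)) < fst (f s))%R in A.
  apply Rabs_def2 in A. lra.
Qed.

(** Near each parameter [K] is constant along the path, so its derivative is 0; the mean value
    theorem then replaces a compactness argument on the interval. *)
Lemma loc_const_path (K : C * C -> C) (p q : R -> C) :
  loc_const K ->
  (forall s, (0 <= s <= 1)%R -> locally s (fun t => Mhat' (p t, q t)) /\
     (exists a, cder p s a) /\ (exists b, cder q s b)) ->
  K (p 1%R, q 1%R) = K (p 0%R, q 0%R).
Proof.
  intros HK H. apply (cder_zero_const (fun s => K (p s, q s))). intros s Hs.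
  destruct (H s Hs) as (HM & [a Ha] & [b Hb]).
  apply cder_ext_loc with (f := fun _ => K (p s, q s)); [|apply cder_const].
  destruct (HK _ (locally_singleton _ _ HM)) as [eps Heps].
  generalize (filter_and _ _ HM (filter_and _ _ (cder_ball p s a eps Ha) (cder_ball q s b eps Hb))).
  apply filter_imp. intros t (A & B & D). symmetry. apply Heps; [split; assumption|exact A].
Qed.

(** The equation of the curve is symmetric, so path lifting also works with [u1] leading and [u2]
    following. *)
Lemma loc_const_swap (K : C * C -> C) :
  loc_const K -> loc_const (fun u => K (snd u, fst u)).
Proof.
  intros HK [u1 u2] Hu. unfold Mhat' in Hu. simpl in *.
  assert (Hu' : Mhat' (u2, u1)) by (unfold Mhat'; simpl; rewrite <- Hu; ring).
  destruct (HK _ Hu') as [eps Heps]. exists eps.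
  intros [v1 v2] [A B] Hv. apply Heps; [split; assumption|].
  unfold Mhat' in *; simpl in *. rewrite <- Hv; ring.
Qed.

(** [u1] follows [log (1 - e^{u2})] along a path of [u2], provided that
    [1 - e^{u2}] stays in one open half plane. *)
Lemma loc_const_lift (K : C * C -> C) (u1 c : C) (w : R -> C) :
  let E z := Cexp c * (1 - Cexp z) in
  loc_const K -> Mhat' (u1, w 0%R) ->
  (forall s, (0 <= s <= 1)%R -> (exists a, cder w s a) /\ (0 < fst (E (w s)))%R) ->
  let u1' := u1 - Clog (E (w 0%R)) + Clog (E (w 1%R)) in
  Mhat' (u1', w 1%R) /\ K (u1', w 1%R) = K (u1, w 0%R).
Proof.
  intros E HK Hu H.
  (* Subtracting the initial logarithm makes the path start at the given [u1], on whichever sheet it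
     lies, and cancels the factor [Cexp c], whose only task is to rotate the half plane. *)
  set (p := fun s => u1 - Clog (E (w 0%R)) + Clog (E (w s))).
  assert (H0 : (0 < fst (E (w 0%R)))%R) by (apply H; lra).
  assert (Hn : 1 - Cexp (w 0%R) <> 0).
  { intro Hz. unfold E in H0. rewrite Hz, Cmult_0_r in H0. simpl in H0. lra. }
  assert (HM : forall s, (0 < fst (E (w s)))%R -> Mhat' (p s, w s)).
  { intros s Hs. unfold Mhat', p in *; simpl in *.
    rewrite Cexp_plus, Cexp_minus, !Cexp_Clog by assumption.
    unfold E. rewrite <- (Mhat'_sub _ _ Hu).
    field. split; [exact Hn|apply Cexp_neq_0]. }
  assert (HE : forall s a, cder w s a -> cder (fun t => E (w t)) s (Cexp c * (0 + (- (1)) * (Cexp (w s) * a)))).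
  { intros s a Ha. unfold E. apply cder_scal.
    apply (cder_ext (fun t => 1 + (- (1)) * Cexp (w t))); [intro; ring|].
    apply cder_plus; [apply cder_const|]. apply cder_scal. now apply cder_Cexp. }
  intro u1'. split; [apply (HM 1%R); apply H; lra|].
  replace u1 with (p 0%R) at 1 by (unfold p; ring).
  apply (loc_const_path K p w HK).
  intros s Hs. destruct (H s Hs) as [[a Ha] Hp].
  split; [|split].
  - generalize (cder_fst_pos _ _ _ (HE s a Ha) Hp). apply filter_imp. exact HM.
  - eexists. unfold p. apply cder_plus; [apply cder_const|].
    apply (cder_Clog (fun t => E (w t))); [exact Hp|exact (HE s a Ha)].
  - now exists a.
Qed.

Lemma fst_one_minus_Cexp (z : C) : (fst z < 0)%R -> (0 < fst (1 - Cexp z)%C)%R.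
Proof.
  destruct z as [x y]; simpl; intro Hx.
  assert (exp x < 1)%R by (rewrite <- exp_0; now apply exp_increasing).
  pose proof (exp_pos x). pose proof (COS_bound y). nra.
Qed.

(** The real sheet over [u2 = -1]. Both coordinates of this point have negative real part, so either
    can lead a lifted path. *)
Definition base1 : C := RtoC (ln (1 - exp (- 1))).

Lemma exp_m1_bounds : (0 < exp (- 1) < 1)%R.
Proof.
  split; [apply exp_pos|]. rewrite <- exp_0. apply exp_increasing; lra.
Qed.

Lemma Cexp_base1 : Cexp base1 = 1 - Cexp (- (1)).
Proof.
  pose proof exp_m1_bounds. unfold Cexp, base1; simpl.
  replace (- (1))%R with (-1)%R by ring.
  rewrite exp_ln, Ropp_0, cos_0, sin_0 by lra.
  apply injective_projections; simpl; ring.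
Qed.

Lemma base1_neg : (fst base1 < 0)%R.
Proof.
  pose proof exp_m1_bounds. simpl. rewrite <- ln_1. apply ln_increasing; lra.
Qed.

Lemma loc_const_base_sheet (K : C * C -> C) (u1 : C) :
  loc_const K -> Mhat' (u1, - (1)) -> K (u1, - (1)) = K (base1, - (1)).
Proof.
  intros HK Hu.
  assert (Hk : Cexp (u1 - base1) = 1).
  { rewrite Cexp_minus, Cexp_base1, (Mhat'_sub _ _ Hu).
    field. apply Cexp_neq_0. }
  assert (Hf : fst u1 = fst base1).
  { apply Cexp_eq_1 in Hk. destruct Hk as [k Hk]. apply (f_equal fst) in Hk.
    simpl in Hk. simpl. lra. }
  pose proof base1_neg as Hb.
  (* A vertical segment: [u1] and [base1] have the same negative real part, so [1 - e^{u1}] keeps a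
     positive real part on it. *)
  set (w := fun s : R => u1 + RtoC s * (base1 - u1)).
  assert (Hw0 : w 0%R = u1) by (unfold w; ring).
  assert (Hw1 : w 1%R = base1) by (unfold w; ring).
  destruct (loc_const_lift (fun u => K (snd u, fst u)) (- (1)) 0 w) as [_ H].
  - now apply loc_const_swap.
  - rewrite Hw0. unfold Mhat' in *; simpl in *. now rewrite Cplus_comm.
  - intros s Hs. split; [eexists; apply cder_line|].
    rewrite Cexp_0, Cmult_1_l. apply fst_one_minus_Cexp.
    unfold w. simpl in *. rewrite Hf in *. lra.
  - rewrite Hw0, Hw1 in H. simpl in H.
    (* With equal exponentials at the two ends, the two logarithms in the lift cancel and [u2]
       returns to [-1]. *)
    replace (Cexp u1) with (Cexp base1) in H.
    + rewrite <- H. f_equal. f_equal. ring.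
    + replace u1 with (u1 - base1 + base1) by ring.
      rewrite Cexp_plus, Hk. ring.
Qed.

(** The segment from [u2] to [-1] stays in the left half plane and lifts, but it ends on an unknown
    sheet; [loc_const_base_sheet] takes over there. *)
Lemma loc_const_left (K : C * C -> C) (u1 u2 : C) :
  loc_const K -> Mhat' (u1, u2) -> (fst u2 < 0)%R -> K (u1, u2) = K (base1, - (1)).
Proof.
  intros HK Hu Hx.
  set (w := fun s : R => u2 + RtoC s * (- (1) - u2)).
  assert (Hw0 : w 0%R = u2) by (unfold w; ring).
  assert (Hw1 : w 1%R = - (1)) by (unfold w; ring).
  destruct (loc_const_lift K u1 0 w) as [HM H]; trivial.
  - now rewrite Hw0.
  - intros s Hs. split; [eexists; apply cder_line|].
    rewrite Cexp_0, Cmult_1_l. apply fst_one_minus_Cexp.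
    unfold w. simpl in *. nra.
  - rewrite Hw1 in HM, H. rewrite Hw0 in H at 2. rewrite <- H.
    now apply loc_const_base_sheet.
Qed.

(** [e^{-iy/2} (1 - e^{x+iy})] has imaginary part [- sin (y/2) (1 + e^x)], of
    constant sign on a horizontal line. *)
Lemma loc_const_off_real (K : C * C -> C) (u1 u2 : C) :
  loc_const K -> Mhat' (u1, u2) -> sin (snd u2 / 2) <> 0%R ->
  K (u1, u2) = K (base1, - (1)).
Proof.
  intros HK Hu Hy. destruct u2 as [x y]; simpl in Hy.
  set (h := (y / 2)%R) in *.
  set (w := fun s : R => ((x, y) : C) + RtoC s * RtoC (- 1 - x)%R).
  assert (Hw : forall s, w s = ((x + s * (-1 - x))%R, y)).
  { intro s. unfold w. apply injective_projections; simpl; ring. }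
  assert (Hw0 : w 0%R = (x, y)) by (rewrite Hw; f_equal; ring).
  (* With [e] the sign of [sin h], the additional quarter turn [e * (PI / 2)] moves the imaginary
     part of constant sign to a positive real part. *)
  assert (Hc : exists c : C, forall t, (0 < fst (Cexp c * (1 - Cexp ((t, y) : C)))%C)%R).
  { assert (HR : forall e t, (e = 1 \/ e = -1)%R ->
      fst (Cexp ((0, e * (PI / 2) - h)%R : C) * (1 - Cexp ((t, y) : C)))
      = (e * sin h * (1 + exp t))%R).
    { intros e t He. unfold Cexp; simpl. replace y with (2 * h)%R by (unfold h; field).
      rewrite exp_0, cos_minus, sin_minus, cos_2a_sin, sin_2a.
      assert (H1 : cos (e * (PI / 2)) = 0%R).
      { destruct He as [-> | ->].
        - rewrite Rmult_1_l. apply cos_PI2.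
        - replace (-1 * (PI / 2))%R with (- (PI / 2))%R by ring. rewrite cos_neg. apply cos_PI2. }
      assert (H2 : sin (e * (PI / 2)) = e).
      { destruct He as [-> | ->].
        - rewrite Rmult_1_l. apply sin_PI2.
        - replace (-1 * (PI / 2))%R with (- (PI / 2))%R by ring.
          rewrite sin_neg, sin_PI2. ring. }
      rewrite H1, H2. pose proof (sin2_cos2 h) as Hsc. unfold Rsqr in Hsc.
      replace (cos h * cos h)%R with (1 - sin h * sin h)%R by lra.
      ring_simplify.
      replace (cos h ^ 2)%R with (1 - sin h * sin h)%R by (simpl; lra). ring. }
    destruct (Rtotal_order (sin h) 0) as [H|[H|H]]; [|contradiction|].
    - exists ((0, -1 * (PI / 2) - h)%R). intro t. rewrite HR by now right.
      pose proof (exp_pos t). nra.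
    - exists ((0, 1 * (PI / 2) - h)%R). intro t. rewrite HR by now left.
      pose proof (exp_pos t). nra. }
  destruct Hc as [c Hc].
  destruct (loc_const_lift K u1 c w) as [HM H]; trivial.
  - now rewrite Hw0.
  - intros s Hs. split; [eexists; apply cder_line|]. rewrite Hw. apply Hc.
  - rewrite Hw0 in H at 2. rewrite <- H. apply loc_const_left; trivial.
    rewrite Hw. simpl. lra.
Qed.

(** From [1 - cos s = 2 sin^2 (s/2) <= s^2 / 2 <= s / 2]. A linear bound suffices for the slanted
    path off the real ray. *)
Lemma cos_ge_line (s : R) : (0 <= s <= 1)%R -> (1 - s / 2 <= cos s)%R.
Proof.
  intro Hs. replace s with (2 * (s / 2))%R at 2 by field. rewrite cos_2a_sin.
  assert (sin (s / 2) <= s / 2)%R.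
  { destruct (Req_dec s 0) as [->|Hn].
    - unfold Rdiv. rewrite Rmult_0_l, sin_0. lra.
    - left. apply sin_lt_x. lra. }
  assert (0 <= sin (s / 2))%R.
  { pose proof PI2_1. apply sin_ge_0; lra. }
  nra.
Qed.

(** Connectedness in the form needed: a locally constant function takes its base point value
    everywhere. Only [y] in [2 pi Z] with [x > 0] needs a new path; [x = 0] would give [e^{u2} = 1]
    and hence [e^{u1} = 0]. *)
Lemma Mhat'_connected (K : C * C -> C) (u : C * C) :
  loc_const K -> Mhat' u -> K u = K (base1, - (1)).
Proof.
  intros HK Hu. destruct u as [u1 [x y]].
  destruct (Req_dec (sin (y / 2)) 0) as [Hy|Hy];
    [|now apply loc_const_off_real].
  destruct (Rlt_le_dec x 0) as [Hx|Hx]; [now apply loc_const_left|].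
  destruct (sin_eq_0_0 _ Hy) as [k Hk].
  assert (Hcs : forall s, cos (y + s) = cos s).
  { intro s. replace (y + s)%R with (s - 2 * PI * IZR (- k))%R
      by (rewrite opp_IZR; lra). apply cos_minus_2kPI. }
  assert (Hx0 : x <> 0%R).
  { intros ->. unfold Mhat' in Hu; simpl in Hu. apply (Cexp_neq_0 u1).
    replace (Cexp u1) with (1 - Cexp ((0%R, y) : C)) by (rewrite <- Hu; ring).
    replace (Cexp ((0%R, y) : C)) with (1 : C); [ring|].
    symmetry. apply Cexp_eq_1. exists k. apply injective_projections; simpl; lra. }
  (* The real speed 2 outweighs the decrease of the cosine: [e^{2s} cos s >= (1 + 2s)(1 - s/2) >= 1]
     for [0 <= s <= 1]. *)
  set (w := fun s : R => ((x, y) : C) + RtoC s * ((2, 1)%R : C)).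
  assert (Hw : forall s, w s = ((x + 2 * s)%R, (y + s)%R)).
  { intro s. unfold w. apply injective_projections; simpl; ring. }
  assert (Hw0 : w 0%R = (x, y)) by (rewrite Hw; f_equal; ring).
  (* Here [Cexp c = -1], because [1 - e^{u2}] is in the left half plane along this path. *)
  destruct (loc_const_lift K u1 ((0, PI)%R : C) w) as [HM H]; trivial.
  - now rewrite Hw0.
  - intros s Hs. split; [eexists; apply cder_line|]. rewrite Hw.
    unfold Cexp; simpl. rewrite exp_0, cos_PI, sin_PI, Hcs, exp_plus.
    assert (1 < exp x)%R by (rewrite <- exp_0; apply exp_increasing; lra).
    assert (1 + 2 * s <= exp (2 * s))%R by apply exp_ineq1_le.
    pose proof (cos_ge_line s Hs).
    assert (1 <= exp (2 * s) * cos s)%R by nra.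
    nra.
  - rewrite Hw0 in H at 2. rewrite <- H. apply loc_const_off_real; trivial.
    rewrite Hw. simpl.
    replace ((y + 1) / 2)%R with (y / 2 + 1 / 2)%R by field.
    rewrite sin_plus, Hy. pose proof (sin2_cos2 (y / 2)) as Hsc. rewrite Hy in Hsc.
    unfold Rsqr in Hsc. pose proof PI2_1.
    assert (0 < sin (1 / 2))%R by (apply sin_gt_0; lra).
    intro E0. assert (cos (y / 2) * sin (1 / 2) = 0)%R by lra.
    apply Rmult_integral in H2. destruct H2; [|lra]. rewrite H2 in Hsc. lra.
Qed.

(** * The bundle [Q] and the connection *)

Lemma continuous_C_pair {T : UniformSpace} (f : T -> C) (x : T) :
  continuous (fun t => fst (f t)) x -> continuous (fun t => snd (f t)) x -> continuous f x.
Proof.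
  intros C1 C2 P [eps HP].
  assert (L1 := C1 _ (locally_ball (fst (f x)) eps)).
  assert (L2 := C2 _ (locally_ball (snd (f x)) eps)).
  unfold filtermap in *.
  generalize (filter_and _ _ L1 L2).
  apply filter_imp. intros t [A B]. apply HP. split; assumption.
Qed.

Lemma continuous_C_fst {T : UniformSpace} (f : T -> C) (x : T) : continuous f x -> continuous (fun t => fst (f t)) x.
Proof. intro H. apply (continuous_comp f (fst : C -> R)); [exact H|]. destruct (f x). apply continuous_fst. Qed.

Lemma continuous_C_snd {T : UniformSpace} (f : T -> C) (x : T) : continuous f x -> continuous (fun t => snd (f t)) x.
Proof. intro H. apply (continuous_comp f (snd : C -> R)); [exact H|]. destruct (f x). apply continuous_snd. Qed.

Lemma continuous_Cplus {T : UniformSpace} (f g : T -> C) (x : T) :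
  continuous f x -> continuous g x -> continuous (fun t => f t + g t) x.
Proof.
  intros H1 H2. apply continuous_C_fst in H1 as F1. apply continuous_C_snd in H1 as S1.
  apply continuous_C_fst in H2 as F2. apply continuous_C_snd in H2 as S2.
  apply continuous_C_pair; simpl.
  - exact (continuous_plus (K := R_AbsRing) (V := R_NormedModule) _ _ _ F1 F2).
  - exact (continuous_plus (K := R_AbsRing) (V := R_NormedModule) _ _ _ S1 S2).
Qed.

Lemma continuous_Cmult {T : UniformSpace} (f g : T -> C) (x : T) :
  continuous f x -> continuous g x -> continuous (fun t => f t * g t) x.
Proof.
  intros H1 H2. apply continuous_C_fst in H1 as F1. apply continuous_C_snd in H1 as S1.
  apply continuous_C_fst in H2 as F2. apply continuous_C_snd in H2 as S2.
  apply continuous_C_pair; simpl.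
  - exact (continuous_minus (K := R_AbsRing) (V := R_NormedModule) _ _ _
      (continuous_mult (K := R_AbsRing) _ _ _ F1 F2) (continuous_mult (K := R_AbsRing) _ _ _ S1 S2)).
  - exact (continuous_plus (K := R_AbsRing) (V := R_NormedModule) _ _ _
      (continuous_mult (K := R_AbsRing) _ _ _ F1 S2) (continuous_mult (K := R_AbsRing) _ _ _ S1 F2)).
Qed.

Lemma continuous_Cexp {T : UniformSpace} (f : T -> C) (x : T) : continuous f x -> continuous (fun t => Cexp (f t)) x.
Proof.
  intro H. apply continuous_C_fst in H as H1. apply continuous_C_snd in H as H2.
  apply continuous_C_pair; simpl; apply (continuous_mult (K := R_AbsRing)).
  - apply (continuous_comp (fun t => fst (f t)) exp); [assumption|apply continuous_exp].
  - apply (continuous_comp (fun t => snd (f t)) cos); [assumption|apply continuous_cos].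
  - apply (continuous_comp (fun t => fst (f t)) exp); [assumption|apply continuous_exp].
  - apply (continuous_comp (fun t => snd (f t)) sin); [assumption|apply continuous_sin].
Qed.

Lemma continuous_Clog {T : UniformSpace} (f : T -> C) (x : T) :
  (0 < fst (f x))%R -> continuous f x -> continuous (fun t => Clog (f t)) x.
Proof.
  intros Hp H. apply continuous_C_fst in H as H1. apply continuous_C_snd in H as H2.
  apply continuous_C_pair; simpl.
  - apply (continuous_mult (K := R_AbsRing)); [|apply continuous_const].
    apply (continuous_comp (fun t => fst (f t) * fst (f t) + snd (f t) * snd (f t))%R ln).
    + apply (continuous_plus (K := R_AbsRing) (V := R_NormedModule));
        now apply (continuous_mult (K := R_AbsRing)).
    + apply (ex_derive_continuous (V := R_NormedModule)). eexists. apply is_derive_ln. nra.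
  - apply (continuous_comp (fun t => snd (f t) * / fst (f t))%R atan);
      [|apply continuous_atan].
    apply (continuous_mult (K := R_AbsRing)); [exact H2|].
    apply (continuous_comp (fun t => fst (f t)) Rinv); [exact H1|].
    apply continuous_Rinv. lra.
Qed.

(** * Quotients, characters of the torus and deck transformations *)

Lemma cls_eq {X : Type} (R : X -> X -> Prop) (x y : X) :
  (forall a b, R a b -> R b a) -> (forall a b c, R a b -> R b c -> R a c) ->
  R x y -> cls R x = cls R y.
Proof.
  intros Hs Ht H. unfold cls. apply subset_eq_compat.
  apply functional_extensionality. intro z. apply propositional_extensionality.
  split; intro Hz; eauto.
Qed.

Lemma repr_cls {X : Type} (R : X -> X -> Prop) (x : X) :
  (forall a, R a a) -> R x (repr (cls R x)).
Proof.
  intro Hr. unfold repr.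
  destruct (constructive_indefinite_description _ _) as [y Hy]. simpl in *.
  rewrite Hy. apply Hr.
Qed.

Lemma cls_repr {X : Type} (R : X -> X -> Prop) (q : quot R) : cls R (repr q) = q.
Proof.
  unfold repr. destruct (constructive_indefinite_description _ _) as [y Hy].
  simpl. destruct q as [P HP]; simpl in *. apply subset_eq_compat. now symmetry.
Qed.

Lemma Cstar_eq (a b : Cstar) : cval a = cval b -> a = b.
Proof.
  destruct a as [a Ha], b as [b Hb]; simpl. intros <-. f_equal. apply proof_irrelevance.
Qed.

(** [chi] is computed from a chosen representative of the point. It differs from [x] by integers,
    which change the exponent by an integer multiple of [2 pi i]. *)
Lemma chi_pt (n : Z * Z) (x : R * R) :
  cval (chi n (pt x)) = Cexp (RtoC (2 * PI) * Ci * RtoC (IZR (fst n) * fst x + IZR (snd n) * snd x)).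
Proof.
  assert (H : torus_rel x (repr (pt x))).
  { apply (repr_cls torus_rel x). intros [a b]. exists 0%Z, 0%Z. simpl. f_equal; ring. }
  destruct H as (m1 & m2 & H). unfold chi. rewrite H. simpl cval.
  set (k := (fst n * m1 + snd n * m2)%Z).
  replace (RtoC (2 * PI) * Ci * RtoC (IZR (fst n) * (fst x + IZR m1) + IZR (snd n) * (snd x + IZR m2)))
    with (RtoC (2 * PI) * Ci * RtoC (IZR (fst n) * fst x + IZR (snd n) * snd x)
          + RtoC (2 * PI) * Ci * RtoC (IZR k)).
  - rewrite Cexp_plus. rewrite (proj2 (Cexp_eq_1 (RtoC (2 * PI) * Ci * RtoC (IZR k)))) by now exists k.
    apply Cmult_1_r.
  - unfold k. rewrite plus_IZR, !mult_IZR. simpl fst; simpl snd.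
    apply injective_projections; simpl; ring.
Qed.

Lemma chi_plus (m n : Z * Z) (theta : torus) :
  chi ((fst m + fst n)%Z, (snd m + snd n)%Z) theta = Cstar_mul (chi m theta) (chi n theta).
Proof.
  apply Cstar_eq. unfold chi; simpl. rewrite <- Cexp_plus. f_equal.
  rewrite !plus_IZR. apply injective_projections; simpl; ring.
Qed.

Lemma deck_plus (m n : Z * Z) (u : C * C) :
  deck ((fst m + fst n)%Z, (snd m + snd n)%Z) u = deck m (deck n u).
Proof.
  unfold deck; simpl. rewrite !plus_IZR, !RtoC_plus.
  apply injective_projections; simpl fst; simpl snd; ring.
Qed.

Lemma chi_0 (theta : torus) : cval (chi (0%Z, 0%Z) theta) = 1.
Proof.
  unfold chi; simpl. rewrite <- Cexp_0 at 1. f_equal.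
  apply injective_projections; simpl; ring.
Qed.

Lemma deck_0 (u : C * C) : deck (0%Z, 0%Z) u = u.
Proof.
  unfold deck; simpl. apply injective_projections; simpl fst; simpl snd; ring.
Qed.

Lemma Qpt_deck (n : Z * Z) (u : C * C) (theta : torus) (lambda : Cstar) :
  Qpt u theta lambda = Qpt (deck n u) theta (Cstar_mul (chi n theta) lambda).
Proof.
  apply cls_eq.
  - intros [[u1 t1] l1] [[u2 t2] l2] [m Hm]. injection Hm as -> -> ->.
    exists ((- fst m)%Z, (- snd m)%Z). f_equal; [f_equal|].
    + rewrite <- deck_plus. simpl fst. simpl snd. rewrite !Z.add_opp_diag_l. symmetry; apply deck_0.
    + apply Cstar_eq.
      change (cval l1 = cval (chi ((- fst m)%Z, (- snd m)%Z) t1) * (cval (chi m t1) * cval l1)).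
      rewrite Cmult_assoc.
      replace (cval (chi ((- fst m)%Z, (- snd m)%Z) t1) * cval (chi m t1)) with (1 : C); [ring|].
      rewrite <- (chi_0 t1). pose proof (chi_plus ((- fst m)%Z, (- snd m)%Z) m t1) as Hd.
      simpl fst in Hd; simpl snd in Hd. rewrite !Z.add_opp_diag_l in Hd.
      now rewrite Hd.
  - intros [[u1 t1] l1] [[u2 t2] l2] [[u3 t3] l3] [m Hm] [m' Hm'].
    injection Hm as -> -> ->. injection Hm' as -> -> ->.
    exists ((fst m' + fst m)%Z, (snd m' + snd m)%Z). f_equal; [f_equal|].
    + now rewrite deck_plus.
    + rewrite chi_plus. apply Cstar_eq; simpl. ring.
  - now exists n.
Qed.

(** The integer nearest to [y / 2 pi]. *)
Definition winding (y : R) : Z := up (y / (2 * PI) - / 2).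

Lemma winding_unique (y : R) (n : Z) :
  (- (PI / 2) < y - 2 * PI * IZR n < PI / 2)%R -> winding y = n.
Proof.
  intro H. symmetry. pose proof PI_RGT_0. unfold winding.
  assert (E : y = (2 * PI * (y / (2 * PI)))%R) by (field; lra).
  set (q := (y / (2 * PI))%R) in *. apply tech_up; nra.
Qed.

(** Rounding alone gives distance at most [PI]; a positive cosine improves this to less than
    [PI / 2]. *)
Lemma winding_bounds (y : R) :
  (0 < cos y)%R -> (- (PI / 2) < y - 2 * PI * IZR (winding y) < PI / 2)%R.
Proof.
  intro Hc. pose proof PI_RGT_0. rewrite <- (cos_minus_2kPI y (winding y)) in Hc.
  unfold winding in *. destruct (archimed (y / (2 * PI) - / 2)) as [A B].
  assert (E : y = (2 * PI * (y / (2 * PI)))%R) by (field; lra).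
  set (q := (y / (2 * PI))%R) in *. set (n := IZR (up (q - / 2))) in *.
  set (r := (y - 2 * PI * n)%R) in *.
  assert (- PI <= r <= PI)%R by (unfold r; split; nra).
  split; apply Rnot_le_lt; intro Hr.
  - rewrite <- cos_neg in Hc. assert (cos (- r) <= 0)%R by (apply cos_le_0; lra). lra.
  - assert (cos r <= 0)%R by (apply cos_le_0; lra). lra.
Qed.

Lemma Clog_Cexp_winding (w : C) :
  (0 < fst (Cexp w))%R ->
  w = Clog (Cexp w) + RtoC (2 * PI) * Ci * RtoC (IZR (winding (snd w))).
Proof.
  intro Hp.
  assert (Hc : (0 < cos (snd w))%R).
  { simpl in Hp. pose proof (exp_pos (fst w)). nra. }
  pose proof (winding_bounds _ Hc) as Hb. set (n := winding (snd w)) in *.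
  replace (Cexp w) with (Cexp (w - RtoC (2 * PI) * Ci * RtoC (IZR n))).
  - rewrite Clog_Cexp; [ring|]. simpl. lra.
  - rewrite Cexp_minus, (proj2 (Cexp_eq_1 (RtoC (2 * PI) * Ci * RtoC (IZR n)))) by now exists n.
    field.
Qed.

(** * Directional derivatives, plane waves and the curvature *)

Lemma locally_line {E : NormedModule R_AbsRing} (x v : E) (s : R) (P : E -> Prop) :
  locally (plus x (scal s v)) P -> locally s (fun t : R => P (plus x (scal t v))).
Proof.
  intro H. revert P H. change (continuous (fun t : R => plus x (scal t v)) s).
  apply (continuous_plus (K := R_AbsRing)); [apply continuous_const|].
  apply (continuous_scal_l (K := R_AbsRing) (fun t : R => t)). apply continuous_id.
Qed.

Lemma dirD_of_cder {E : NormedModule R_AbsRing} (f : E -> C) (x v : E) (l : C) :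
  cder (fun s => f (plus x (scal s v))) 0%R l -> ex_dirD f x v /\ dirD f x v = l.
Proof.
  intros [H1 H2]. split.
  - split; [exists (fst l)|exists (snd l)]; assumption.
  - apply injective_projections; simpl; now apply is_derive_unique.
Qed.

Lemma cder_of_dirD {E : NormedModule R_AbsRing} (f : E -> C) (x v : E) :
  ex_dirD f x v -> cder (fun s => f (plus x (scal s v))) 0%R (dirD f x v).
Proof.
  intros [H1 H2]. split; simpl; now apply Derive_correct.
Qed.

Definition plane_wave (n : Z * Z) (y : VC2R2) : C :=
  Cexp (RtoC (2 * PI) * Ci * RtoC (IZR (fst n) * fst (snd y) + IZR (snd n) * snd (snd y))).

Lemma plane_wave_dirD (f : VC2R2 -> C) (c : C) (n : Z * Z) (y v : VC2R2) :
  locally y (fun y' => f y' = c * plane_wave n y') ->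
  ex_dirD f y v /\
  dirD f y v = c * (RtoC (2 * PI) * Ci *
                 RtoC (IZR (fst n) * fst (snd v) + IZR (snd n) * snd (snd v))) * plane_wave n y.
Proof.
  intro H. apply dirD_of_cder.
  assert (Hy : plus y (scal 0%R v) = y) 
    by (rewrite (scal_zero_l v : scal 0%R v = zero); apply plus_zero_r).
  rewrite <- Hy in H. apply locally_line in H.
  apply cder_ext_loc with (f := fun s => c * plane_wave n (plus y (scal s v))).
  { revert H. apply filter_imp. intros t Ht. now symmetry. }
  eapply cder_eq.
  - apply cder_scal. unfold plane_wave.
    apply (cder_Cexp (fun s => RtoC (2 * PI) * Ci *
       RtoC (IZR (fst n) * fst (snd (plus y (scal s v))) + IZR (snd n) * snd (snd (plus y (scal s v)))))).
    apply (cder_ext (fun s : R => RtoC (2 * PI) * Ci * RtoC (IZR (fst n) * fst (snd y) + IZR (snd n) * snd (snd y))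
       + RtoC s * (RtoC (2 * PI) * Ci *
                 RtoC (IZR (fst n) * fst (snd v) + IZR (snd n) * snd (snd v))))); [|apply cder_line].
    intro t. destruct y as [u [x1 x2]], v as [du [v1 v2]].
    unfold plus, scal; simpl; unfold plus, scal, mult; simpl; unfold mult; simpl.
    apply injective_projections; simpl; ring.
  - cbv beta. fold (plane_wave n (plus y (scal 0%R v))). rewrite Hy. ring.
Qed.

Lemma continuous_plane_wave (n : Z * Z) (y : VC2R2) : continuous (plane_wave n) y.
Proof.
  assert (C : continuous (snd : VC2R2 -> VR2) y) by (destruct y; apply continuous_snd).
  assert (C1 : continuous (fun y : VC2R2 => fst (snd y)) y).
  { apply (continuous_comp (snd : VC2R2 -> VR2) (fst : VR2 -> R)); [exact C|].
    destruct (snd y); apply continuous_fst. }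
  assert (C2 : continuous (fun y : VC2R2 => snd (snd y)) y).
  { apply (continuous_comp (snd : VC2R2 -> VR2) (snd : VR2 -> R)); [exact C|].
    destruct (snd y); apply continuous_snd. }
  apply (continuous_Cexp (T := VC2R2)), (continuous_Cmult (T := VC2R2)); [apply continuous_const|].
  apply (continuous_C_pair (T := VC2R2)); [|apply continuous_const].
  exact (continuous_plus (K := R_AbsRing) (V := R_NormedModule) _ _ _
    (continuous_mult (K := R_AbsRing) (fun _ : VC2R2 => IZR (fst n)) _ _ (continuous_const _ _) C1)
    (continuous_mult (K := R_AbsRing) (fun _ : VC2R2 => IZR (snd n)) _ _ (continuous_const _ _) C2)).
Qed.

(** A directional derivative of a function locally of the form [c * plane_wave n] has the same form
    with the same [n] and another [c], so the recursion in [Ck_on] closes. The pair may depend on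
    the point because sheet numbers are only locally constant. *)
Lemma smooth_plane_wave (D : VC2R2 -> Prop) (f : VC2R2 -> C) :
  (forall y, D y -> exists c n, locally y (fun y' => f y' = c * plane_wave n y')) ->
  smooth_on D f.
Proof.
  intros H k. revert f H.
  assert (HC : forall f : VC2R2 -> C,
    (forall y, D y -> exists c n, locally y (fun y' => f y' = c * plane_wave n y')) ->
    forall y, D y -> continuous f y).
  { intros f H y Hy. destruct (H y Hy) as (c & n & Hl).
    apply (continuous_ext_loc f (fun y' => c * plane_wave n y')).
    - revert Hl. apply filter_imp. intros t Ht. now symmetry.
    - apply continuous_Cmult; [apply continuous_const|apply continuous_plane_wave]. }
  induction k as [|k IH]; intros f H; split; try exact (HC f H).
  - exact I.
  - intro v. split.
    + intros y Hy. destruct (H y Hy) as (c & n & Hl). exact (proj1 (plane_wave_dirD f c n y v Hl)).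
    + apply IH. intros y Hy. destruct (H y Hy) as (c & n & Hl).
      exists (c * (RtoC (2 * PI) * Ci *
                 RtoC (IZR (fst n) * fst (snd v) + IZR (snd n) * snd (snd v)))), n.
      apply locally_locally in Hl. revert Hl. apply filter_imp. intros y' Hy'.
      exact (proj2 (plane_wave_dirD f c n y' v Hy')).
Qed.

Lemma VC_line (z v : C) (t : R) : plus (z : VC) (scal t (v : VC)) = z + RtoC t * v.
Proof.
  apply injective_projections; simpl; unfold plus, scal; simpl; unfold mult; simpl; ring.
Qed.

Lemma dirD_const {E : NormedModule R_AbsRing} (c : C) (x v : E) : dirD (fun _ => c) x v = 0.
Proof. apply (dirD_of_cder (fun _ => c)). apply cder_const. Qed.

Lemma pull_eta_one (y v : VC2R2) :
  pull_eta (fun _ => Cstar_one) y v =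
  - fst (fst y) * RtoC (fst (snd v)) - snd (fst y) * RtoC (snd (snd v)).
Proof.
  unfold pull_eta, eta_hat. rewrite dirD_const. unfold Cstar_one; simpl. rewrite Cexp_0.
  unfold Cdiv. ring.
Qed.

(** The curvature is [- du1 /\ dtheta1 - du2 /\ dtheta2]; the connection form has coefficients
    linear in [u], so it is affine along every line. *)
Lemma Omega_eq (y v w : VC2R2) :
  Omega y v w =
  (- fst (fst v) * RtoC (fst (snd w)) - snd (fst v) * RtoC (snd (snd w)))
  - (- fst (fst w) * RtoC (fst (snd v)) - snd (fst w) * RtoC (snd (snd v))).
Proof.
  assert (H : forall y v w, dirD (fun y => pull_eta (fun _ => Cstar_one) y w) y v =
     - fst (fst v) * RtoC (fst (snd w)) - snd (fst v) * RtoC (snd (snd w))).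
  { clear. intros y v w. apply dirD_of_cder.
    apply (cder_ext (fun s : R => pull_eta (fun _ => Cstar_one) y w
       + RtoC s * (- fst (fst v) * RtoC (fst (snd w)) - snd (fst v) * RtoC (snd (snd w)))));
      [|apply cder_line].
    intro t. rewrite !pull_eta_one.
    change (fst (fst (plus y (scal t v)))) with (plus (fst (fst y) : VC) (scal t (fst (fst v) : VC))).
    change (snd (fst (plus y (scal t v)))) with (plus (snd (fst y) : VC) (scal t (snd (fst v) : VC))).
    rewrite !VC_line. ring. }
  unfold Omega, ext_d. now rewrite !H.
Qed.

Lemma torus_int_const (c : C) : torus_int (fun _ => c) = c.
Proof.
  unfold torus_int. rewrite (RInt_const (V := C_R_CompleteNormedModule)).
  rewrite (RInt_const (V := C_R_CompleteNormedModule)).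
  unfold scal; simpl. unfold prod_scal; simpl. unfold scal; simpl. unfold mult; simpl.
  apply injective_projections; simpl; ring.
Qed.

(** The term [dlambda / lambda] vanishes, which requires [lam = 1] on neighborhoods and not just on
    the fiber. What remains is constant on a torus of area 1. *)
Lemma CS_conn_eq (lam : VC2R2 -> Cstar) (u udot : VC2) :
  (forall x : VR2, locally ((u, x) : VC2R2) (fun y => cval (lam y) = 1)) ->
  CS_conn lam u udot = Ci / RtoC (4 * PI) * (snd u * fst udot - fst u * snd udot).
Proof.
  intro H. unfold CS_conn. f_equal.
  rewrite <- (torus_int_const (snd u * fst udot - fst u * snd udot)). f_equal.
  apply functional_extensionality. intro x.
  assert (He : forall v : VC2R2, pull_eta lam (u, x) v =
     - fst u * RtoC (fst (snd v)) - snd u * RtoC (snd (snd v))).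
  { intro v. unfold pull_eta, eta_hat.
    assert (Hl' : locally ((u, x) : VC2R2) (fun y => cval (lam y) = 1 * plane_wave (0%Z, 0%Z) y)).
    { generalize (H x). apply filter_imp. intros y ->. unfold plane_wave.
      replace (RtoC (2 * PI) * Ci * _) with (0 : C).
      - rewrite Cexp_0. ring.
      - apply injective_projections; simpl; ring. }
    assert (Hd := proj2 (plane_wave_dirD _ _ _ _ v Hl')). simpl fst in Hd. simpl snd in Hd.
    rewrite !Rmult_0_l, Rplus_0_l, Cmult_0_r, Cmult_0_r, Cmult_0_l in Hd.
    match goal with |- context [dirD ?f ?y v] => replace (dirD f y v) with (0 : C) by (symmetry; exact Hd) end.
    simpl fst. simpl snd. unfold Cdiv. ring. }
  unfold wedge12. rewrite !He, !Omega_eq. simpl. unfold zero; simpl.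
  unfold Cplus, Cmult, Cminus, Copp, RtoC; simpl.
  apply injective_projections; simpl; ring.
Qed.

(** * Flat sections in a logarithmic chart *)

Lemma winding_locally (y : R) :
  (0 < cos y)%R -> locally y (fun y' => winding y' = winding y).
Proof.
  intro Hc. destruct (winding_bounds y Hc) as [A B].
  set (r := (y - 2 * PI * IZR (winding y))%R) in *.
  assert (He : (0 < Rmin (PI / 2 - r) (r + PI / 2))%R) by (apply Rmin_pos; lra).
  exists (mkposreal _ He). intros y' Hy'.
  change (Rabs (y' - y) < Rmin (PI / 2 - r) (r + PI / 2))%R in Hy'.
  pose proof (Rmin_l (PI / 2 - r) (r + PI / 2)). pose proof (Rmin_r (PI / 2 - r) (r + PI / 2)).
  apply Rabs_def2 in Hy'. apply winding_unique. unfold r in *. lra.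
Qed.

Lemma locally_pos {T : UniformSpace} (f : T -> C) (x : T) :
  continuous f x -> (0 < fst (f x))%R -> locally x (fun t => 0 < fst (f t))%R.
Proof.
  intros Hf Hp.
  exact (continuous_C_fst f x Hf _ (open_gt 0 (fst (f x)) Hp)).
Qed.

(** A product of two half planes around [e_map u0]. Division by the exponentials turns both into the
    right half plane, so [Clog] serves every chart. Coordinates are plain complex numbers, so
    [(z, 1 - z)] can be inserted without proofs that it avoids 0. *)
Definition in_chart (u0 mu : C * C) : Prop :=
  (0 < fst (fst mu / Cexp (fst u0))%C)%R /\ (0 < fst (snd mu / Cexp (snd u0))%C)%R.

Definition chart_log (u0 mu : C * C) : C * C :=
  (fst u0 + Clog (fst mu / Cexp (fst u0)), snd u0 + Clog (snd mu / Cexp (snd u0))).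

Lemma Cexp_add_Clog (a z : C) :
  (0 < fst (z / Cexp a)%C)%R -> Cexp (a + Clog (z / Cexp a)) = z.
Proof.
  intro H. rewrite Cexp_plus, Cexp_Clog by assumption. field. apply Cexp_neq_0.
Qed.

Lemma add_Clog_Cexp (a w : C) :
  (- (PI / 2) < snd (w - a)%C < PI / 2)%R -> a + Clog (Cexp w / Cexp a) = w.
Proof.
  intro H. rewrite <- Cexp_minus, Clog_Cexp by assumption. ring.
Qed.

Lemma in_chart_neq_0 (a z : C) : (0 < fst (z / Cexp a)%C)%R -> z <> 0.
Proof.
  intros H ->. unfold Cdiv in H. rewrite Cmult_0_l in H. simpl in H. lra.
Qed.

(** For [u] over the chart, the deck transformation that carries [chart_log u0] of the image of [u]
    back to [u]. *)
Definition chart_winding (u0 u : C * C) : Z * Z :=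
  (winding (snd (fst u - fst u0)%C), winding (snd (snd u - snd u0)%C)).

Definition chart_section (u0 : C * C) (mu : MT) (theta : torus) : Q :=
  t0hat (chart_log u0 (cval (fst mu), cval (snd mu))) theta.

(** [chart_section u0] described on the covering, as in [smooth_section_over]. *)
Definition chart_lam (u0 : C * C) (y : VC2R2) : Cstar :=
  chi (chart_winding u0 (fst y)) (pt (snd y)).

Lemma cos_of_Cexp_pos (w a : C) : (0 < fst (Cexp w / Cexp a)%C)%R -> (0 < cos (snd (w - a)%C))%R.
Proof.
  rewrite <- Cexp_minus. unfold Cexp; simpl. intro H.
  pose proof (exp_pos (fst w + - fst a)). nra.
Qed.

(** Over the chart the imaginary parts of [u - u0] stay away from the odd multiples of [PI], where
    the nearest integer jumps. *)
Lemma chart_lam_locally (u0 u : C * C) (x : VR2) :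
  in_chart u0 (Cexp (fst u), Cexp (snd u)) ->
  locally ((u, x) : VC2R2)
    (fun y => cval (chart_lam u0 y) = plane_wave (chart_winding u0 u) y).
Proof.
  intros [H1 H2]. cbn [fst snd] in H1, H2.
  apply cos_of_Cexp_pos in H1, H2.
  assert (C0 : @continuous VC2R2 VC2 fst ((u, x) : VC2R2)) by exact (@continuous_fst VC2 VR2 u x).
  assert (F1 : @continuous VC2 VC fst (u : VC2)) by (destruct u; exact (@continuous_fst VC VC _ _)).
  assert (F2 : @continuous VC2 VC snd (u : VC2)) by (destruct u; exact (@continuous_snd VC VC _ _)).
  assert (C1 : continuous (fun y : VC2R2 => snd (fst (fst y) - fst u0)%C) ((u, x) : VC2R2)).
  { apply (continuous_C_snd (T := VC2R2)), (continuous_Cplus (T := VC2R2)); [|apply filterlim_const].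
    exact (@continuous_comp VC2R2 VC2 VC _ _ _ C0 F1). }
  assert (C2 : continuous (fun y : VC2R2 => snd (snd (fst y) - snd u0)%C) ((u, x) : VC2R2)).
  { apply (continuous_C_snd (T := VC2R2)), (continuous_Cplus (T := VC2R2)); [|apply filterlim_const].
    exact (@continuous_comp VC2R2 VC2 VC _ _ _ C0 F2). }
  assert (L1 := C1 _ (winding_locally _ H1)). assert (L2 := C2 _ (winding_locally _ H2)).
  unfold filtermap in L1, L2.
  generalize (filter_and _ _ L1 L2). apply filter_imp. intros y [E1 E2].
  unfold chart_lam, plane_wave. rewrite chi_pt.
  replace (chart_winding u0 (fst y)) with (chart_winding u0 u); [reflexivity|].
  unfold chart_winding. f_equal; symmetry; [exact E1|exact E2].
Qed.

Lemma chart_section_smooth (u0 : C * C) :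
  smooth_section_over (fun mu => in_chart u0 (cval (fst mu), cval (snd mu)))
    (chart_section u0) (chart_lam u0).
Proof.
  split.
  - intros u x [H1 H2]. cbn [fst snd e_map Cstar_exp cval] in H1, H2. unfold chart_section, t0hat, chart_log, chart_lam.
    cbn [fst snd e_map Cstar_exp cval].
    rewrite (Qpt_deck (chart_winding u0 u)). f_equal.
    + unfold deck, chart_winding. destruct u as [w1 w2], u0 as [a1 a2]. cbn [fst snd] in *.
      f_equal.
      * rewrite <- Cexp_minus in *. pose proof (Clog_Cexp_winding _ H1) as E.
        rewrite <- Cplus_assoc, <- E. ring.
      * rewrite <- Cexp_minus in *. pose proof (Clog_Cexp_winding _ H2) as E.
        rewrite <- Cplus_assoc, <- E. ring.
    + apply Cstar_eq. simpl. rewrite Cexp_0. apply Cmult_1_r.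
  - apply smooth_plane_wave. intros [u x] H.
    exists 1, (chart_winding u0 u). generalize (chart_lam_locally u0 u x H).
    apply filter_imp. intros y ->. ring.
Qed.

Lemma open_right_half_plane (a : C) (z : C) :
  (0 < fst (z / Cexp a)%C)%R -> exists eps : posreal, forall w : C,
    (Cmod (w - z) < eps)%R -> (0 < fst (w / Cexp a)%C)%R.
Proof.
  intro H. assert (Ha := proj1 (Cmod_gt_0 _) (Cexp_neq_0 a)).
  (* The distance from [z] to the boundary line of the half plane. *)
  assert (He : (0 < fst (z / Cexp a)%C * Cmod (Cexp a))%R) by now apply Rmult_lt_0_compat.
  exists (mkposreal _ He). simpl pos. intros w Hw.
  assert (Hd : (Cmod ((w - z) / Cexp a) < fst (z / Cexp a)%C)%R).
  { rewrite Cmod_div by apply Cexp_neq_0. now apply Rlt_div_l. }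
  replace (w / Cexp a) with (z / Cexp a + (w - z) / Cexp a) by (field; apply Cexp_neq_0).
  pose proof (re_le_Cmod ((w - z) / Cexp a)) as Hr. unfold Re in Hr.
  pose proof (Rle_abs (- fst ((w - z) / Cexp a)%C)) as Hn. rewrite Rabs_Ropp in Hn.
  change (0 < fst (z / Cexp a)%C + fst ((w - z) / Cexp a)%C)%R. lra.
Qed.

Lemma winding_add_Clog (a c : C) : winding (snd (a + Clog c - a)%C) = 0%Z.
Proof.
  replace (a + Clog c - a) with (Clog c) by ring.
  apply winding_unique. unfold Clog. cbn [snd].
  pose proof (atan_bound (snd c * / fst c)). lra.
Qed.

(** In the chart [tau' = g tau_t], where [tau_t] is [tau0hat] along [chart_log] and [g] is the
    inverse of [phi]. Flatness reads [dg = - g A], with [du1 = v / z] and [du2 = - v / (1 - z)] in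
    [A]. *)
Lemma flat_section_transport (tau0hat : C * C -> pre_fiber) (tau' : MT -> pre_fiber)
    (phi : C * C -> C) (u0 : C * C) (z v : C) :
  (forall u, triv_at (e_map u) (t0hat u) (tau0hat u)) ->
  flat_section tau' ->
  (forall u t, Mhat' u -> tau0hat u t = phi u * tau' (e_map u) t) ->
  in_chart u0 (z, 1 - z) ->
  let g z := / phi (chart_log u0 (z, 1 - z)) in
  let u := chart_log u0 (z, 1 - z) in
  cder (fun s => g (z + RtoC s * v)) 0
    (- g z * (Ci / RtoC (4 * PI) * (snd u * (v / z) + fst u * (v / (1 - z))))).
Proof.
  intros Htriv [_ Hflat] Hphi Hz g u.
  destruct (Hflat (fun mu => in_chart u0 (cval (fst mu), cval (snd mu)))
    (chart_section u0) (chart_lam u0)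
    (fun mu => tau0hat (chart_log u0 (cval (fst mu), cval (snd mu)))) g) as [Hs Hd].
  - intros mu [H1 H2].
    destruct (open_right_half_plane _ _ H1) as [e1 He1].
    destruct (open_right_half_plane _ _ H2) as [e2 He2].
    exists (mkposreal _ (Rmin_stable_in_posreal e1 e2)). simpl pos. intros nu N1 N2.
    split.
    + apply He1. eapply Rlt_le_trans; [exact N1|apply Rmin_l].
    + apply He2. eapply Rlt_le_trans; [exact N2|apply Rmin_r].
  - apply chart_section_smooth.
  - intros mu [H1 H2]. cbn [fst snd e_map Cstar_exp cval] in H1, H2.
    replace mu with (e_map (chart_log u0 (cval (fst mu), cval (snd mu)))) at 1; [apply Htriv|].
    destruct mu as [m1 m2]. unfold e_map, chart_log. simpl in *.
    f_equal; apply Cstar_eq; simpl; now apply Cexp_add_Clog.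
  - intros mu t [H1 H2] HM. cbn [fst snd e_map Cstar_exp cval] in H1, H2. unfold g. unfold MT' in HM.
    replace (1 - cval (fst mu)) with (cval (snd mu)) by (rewrite <- HM; ring).
    set (w := chart_log u0 (cval (fst mu), cval (snd mu))).
    assert (Ee : e_map w = mu).
    { destruct mu as [m1 m2]. unfold w, e_map, chart_log. simpl in *.
      f_equal; apply Cstar_eq; simpl; now apply Cexp_add_Clog. }
    assert (Hw : Mhat' w).
    { unfold Mhat'. rewrite <- Ee in HM. exact HM. }
    rewrite (Hphi w t Hw), Ee. field.
    (* [phi w] cannot vanish, since [tau0hat w] takes the value 1 at [t0hat w]. *)
    intro Hp. pose proof (Htriv w) as [_ H1w].
    rewrite (Hphi w _ Hw), Hp, Cmult_0_l in H1w. injection H1w. lra.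
  - destruct Hz as [H1 H2]. cbn [fst snd e_map Cstar_exp cval] in H1, H2.
    assert (N1 := in_chart_neq_0 _ _ H1). assert (N2 := in_chart_neq_0 _ _ H2).
    assert (E1 : Cexp (fst u) = z) by (apply Cexp_add_Clog; exact H1).
    assert (E2 : Cexp (snd u) = 1 - z) by (apply Cexp_add_Clog; exact H2).
    assert (HU : in_chart u0 (cval (fst (e_map u)), cval (snd (e_map u)))).
    { cbn [fst snd e_map Cstar_exp cval]. rewrite E1, E2. split; assumption. }
    assert (HM : MT' (e_map u)).
    { unfold MT'; cbn [fst snd e_map Cstar_exp cval]. rewrite E1, E2. ring. }
    assert (Hex : ex_dirD (E := VC) g z v).
    { apply (proj1 (proj2 (Hs 1%nat) v)). exists (e_map u). split; [exact HU|]. split; [exact HM|].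
      exact E1. }
    (* The lift to logarithmic coordinates of the tangent vector [(v, -v)] of the curve. *)
    specialize (Hd u (v / z, - v / (1 - z)) v HU HM).
    cbn [fst snd] in Hd. rewrite E1, E2 in Hd.
    assert (Hd' := Hd ltac:(field; exact N1) ltac:(field; exact N2)). clear Hd.
    rewrite CS_conn_eq in Hd'.
    + apply (cder_ext (fun s : R => g (plus (z : VC) (scal s (v : VC))))).
      { intro s. now rewrite VC_line. }
      eapply cder_eq; [exact (cder_of_dirD (E := VC) g z v Hex)|].
      assert (Hopp : forall a b : C, a + b = 0 -> a = - b).
      { intros a b E. replace a with (a + b - b) by ring. rewrite E. ring. }
      transitivity (- (g z * (Ci / RtoC (4 * PI) * (snd u * (v / z) - fst u * (- v / (1 - z)))))).
      { exact (Hopp _ _ Hd'). }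
      field. repeat split; try assumption.
      intro HP. injection HP. pose proof PI_RGT_0. lra.
    + intro x.
      (* The point [u] lies on the sheet of the branch itself, so the describing character is
         trivial near it. *)
      assert (W : chart_winding u0 u = (0%Z, 0%Z)).
      { unfold chart_winding, u, chart_log. cbn [fst snd]. now rewrite !winding_add_Clog. }
      generalize (chart_lam_locally u0 u x HU). apply filter_imp. intros y ->.
      rewrite W. unfold plane_wave. replace (RtoC (2 * PI) * Ci * _) with (0 : C).
      * apply Cexp_0.
      * apply injective_projections; simpl; ring.
Qed.

(** * Comparison with the dilogarithm *)

Lemma repr_to_C4pi2 (z : C) : exists k : Z, repr (to_C4pi2 z) = z + RtoC (4 * PI * PI * IZR k).
Proof.
  apply (repr_cls four_pi2_rel z). intro a. exists 0%Z.
  rewrite Rmult_0_r. ring.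
Qed.

Lemma to_C4pi2_shift (z : C) (k : Z) : to_C4pi2 (z + RtoC (4 * PI * PI * IZR k)) = to_C4pi2 z.
Proof.
  symmetry. apply cls_eq.
  - intros a b [m ->]. exists (- m)%Z. rewrite opp_IZR, <- Ropp_mult_distr_r, RtoC_opp. ring.
  - intros a b c [m ->] [n ->]. exists (m + n)%Z.
    rewrite plus_IZR, Rmult_plus_distr_l, RtoC_plus. ring.
  - now exists k.
Qed.

Definition two_pi_i : C := RtoC (2 * PI) * Ci.

Lemma two_pi_i_neq_0 : two_pi_i <> 0.
Proof. intro H. injection H. pose proof PI_RGT_0. lra. Qed.

(** Division by [2 pi i] thus maps [4 pi^2 Z] onto the periods of [Cexp], with [k] changing sign. *)
Lemma four_pi2_two_pi_i (k : Z) :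
  RtoC (4 * PI * PI * IZR k) = - (two_pi_i * two_pi_i * RtoC (IZR k)).
Proof. apply injective_projections; simpl; ring. Qed.

Lemma exp_over_2pii_to_C4pi2 (z : C) : exp_over_2pii (to_C4pi2 z) = Cexp (z / two_pi_i).
Proof.
  unfold exp_over_2pii. fold two_pi_i.
  destruct (repr_to_C4pi2 z) as [k ->].
  replace ((z + RtoC (4 * PI * PI * IZR k)) / two_pi_i)
    with (z / two_pi_i + two_pi_i * RtoC (IZR (- k))).
  - rewrite Cexp_plus, (proj2 (Cexp_eq_1 (two_pi_i * RtoC (IZR (- k))))) by now exists (- k)%Z.
    ring.
  - rewrite four_pi2_two_pi_i, opp_IZR, RtoC_opp. field. apply two_pi_i_neq_0.
Qed.

(** Puts the coefficient of the Chern-Simons connection in the form of that of [u1 u2 / 2] after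
    division by [2 pi i]. *)
Lemma Ci_4pi : Ci / RtoC (4 * PI) = - (/ (RtoC 2 * two_pi_i)).
Proof.
  assert (HPI : RtoC PI <> 0) by (intro H; injection H; apply PI_neq0).
  assert (HC : Ci * Ci = - (1)) by (apply injective_projections; simpl; ring).
  assert (Hi : Ci <> 0) by (intro H; injection H; lra).
  assert (H2 : RtoC 2 <> 0) by (intro H; injection H; lra).
  unfold two_pi_i. replace (RtoC (4 * PI)) with (RtoC 2 * RtoC 2 * RtoC PI)
    by (rewrite <- !RtoC_mult; f_equal; ring).
  rewrite RtoC_mult. replace Ci with (Ci * Ci / Ci) at 1 by (field; exact Hi).
  rewrite HC. field. repeat split; assumption.
Qed.

(** The chosen representatives may jump by [4 pi^2 Z] from point to point; the exponential does not
    see this. *)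
Definition exp_ratio (F : C -> C4pi2) (L : C * C -> C4pi2) (u : C * C) : C :=
  Cexp ((repr (L u) - repr (F (snd u)) - fst u * snd u / RtoC 2) / two_pi_i).

Lemma loc_const_exp_ratio (F : C -> C4pi2) (L : C * C -> C4pi2) :
  dilog_continuation F -> CS_function L -> loc_const (exp_ratio F L).
Proof.
  intros [hF _] (tau0hat & tau' & phi & Htriv & Hflat & _ & Hphi & HL) u0 Hu0.
  set (z0 := Cexp (fst u0)).
  assert (Hz0 : 1 - z0 = Cexp (snd u0)).
  { unfold z0. unfold Mhat' in Hu0. rewrite <- Hu0. ring. }
  destruct (hF (snd u0)) as [f Hf].
  { intros k Hk. apply (Cexp_neq_0 (fst u0)). fold z0.
    replace z0 with (1 - Cexp (snd u0)) by (rewrite <- Hz0; ring).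
    rewrite (proj2 (Cexp_eq_1 (snd u0))); [ring|]. exists k. rewrite Hk.
    rewrite RtoC_mult. ring. }
  set (good := fun w => F w = to_C4pi2 (f w) /\ is_derive f w (- w / (1 - Cexp (- w)))) in *.
  pose proof two_pi_i_neq_0 as HP.
  set (chart := fun z => chart_log u0 (z, 1 - z)).
  (* The inverse of the ratio in the coordinate [z], with the differentiable local lift [f] of [F]
     in place of representatives. *)
  set (G := fun z => / phi (chart z) *
     Cexp ((f (snd (chart z)) + fst (chart z) * snd (chart z) / RtoC 2) / two_pi_i)).
  assert (Hchart : forall z, in_chart u0 (z, 1 - z) ->
     Cexp (fst (chart z)) = z /\ Cexp (snd (chart z)) = 1 - z).
  { intros z [H1 H2]. split; now apply Cexp_add_Clog. }
  assert (HK : forall z, in_chart u0 (z, 1 - z) -> good (snd (chart z)) ->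
     exp_ratio F L (chart z) = / G z).
  { intros z Hz [Hg _]. destruct (Hchart z Hz) as [E1 E2].
    assert (Hm : Mhat' (chart z)) by (unfold Mhat'; rewrite E1, E2; ring).
    unfold G. rewrite (HL _ Hm). unfold exp_ratio, exp_over_2pii. fold two_pi_i.
    assert (HFf : Cexp (repr (F (snd (chart z))) / two_pi_i) = Cexp (f (snd (chart z)) / two_pi_i)).
    { now rewrite <- (exp_over_2pii_to_C4pi2 (f (snd (chart z)))), <- Hg. }
    set (a := repr (L (chart z))). set (b := repr (F (snd (chart z)))) in *.
    set (h := fst (chart z) * snd (chart z) / RtoC 2). set (c := f (snd (chart z))) in *.
    replace ((a - b - h) / two_pi_i) with (a / two_pi_i - b / two_pi_i - h / two_pi_i)
      by (field; exact HP).
    replace ((c + h) / two_pi_i) with (c / two_pi_i + h / two_pi_i) by (field; exact HP).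
    rewrite !Cexp_minus, Cexp_plus, HFf. field. repeat split; apply Cexp_neq_0. }
  assert (Hone : forall a : C, (0 < fst (Cexp a / Cexp a)%C)%R).
  { intro a. rewrite <- Cexp_minus. replace (a - a) with (0 : C) by ring.
    rewrite Cexp_0. simpl. lra. }
  assert (Hin0 : in_chart u0 (z0, 1 - z0)).
  { split; cbn [fst snd]; [|rewrite Hz0]; apply Hone. }
  assert (Hc0 : chart z0 = u0).
  { unfold chart, chart_log. cbn [fst snd]. rewrite Hz0. unfold z0.
    assert (Hs : forall a, a + Clog (Cexp a / Cexp a) = a).
    { intro a. apply add_Clog_Cexp. replace (a - a) with (0 : C) by ring.
      pose proof PI_RGT_0. simpl. lra. }
    rewrite !Hs. now destruct u0. }
  assert (Cid : forall a : C, continuous (fun z : C => z / Cexp a) z0).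
  { intro a. apply continuous_Cmult; [apply continuous_id|apply filterlim_const]. }
  assert (Cid' : forall a : C, continuous (fun z : C => (1 - z) / Cexp a) z0).
  { intro a. apply continuous_Cmult; [|apply filterlim_const].
    apply (continuous_ext_loc _ (fun z : C => 1 + (- (1)) * z)).
    { apply filter_forall. intro z. change (1 + - (1) * z = 1 - z). ring. }
    apply continuous_Cplus; [apply filterlim_const|].
    apply continuous_Cmult; [apply filterlim_const|apply continuous_id]. }
  assert (Hloc : locally z0 (fun z => in_chart u0 (z, 1 - z) /\ good (snd (chart z)))).
  { apply filter_and; [apply filter_and|].
    - apply (locally_pos _ _ (Cid _)). exact (proj1 Hin0).
    - apply (locally_pos _ _ (Cid' _)). exact (proj2 Hin0).
    - assert (C2 : continuous (fun z : C => snd (chart z)) z0).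
      { unfold chart, chart_log; cbn [fst snd].
        apply continuous_Cplus; [apply filterlim_const|].
        apply continuous_Clog; [exact (proj2 Hin0)|apply Cid']. }
      apply C2. rewrite Hc0. exact Hf. }
  destruct Hloc as [delta Hdelta].
  assert (HG : forall z, ball (M := C_UniformSpace) z0 delta z -> G z = G z0).
  { intros z [B1 B2]. set (v := z - z0).
    change (Rabs (fst z - fst z0) < delta)%R in B1. change (Rabs (snd z - snd z0) < delta)%R in B2.
    set (gam := fun s : R => z0 + RtoC s * v).
    replace z with (gam 1%R) by (unfold gam, v; ring).
    replace z0 with (gam 0%R) at 1 by (unfold gam; ring).
    apply (cder_zero_const (fun s => G (gam s))). intros s Hs.
    destruct (Hdelta (gam s)) as [Hin [_ Hg]].
    (* Balls of [C_UniformSpace] are squares, so the segment from [z0] is kept inside coordinate by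
       coordinate. *)
    { assert (Hb : forall d, (Rabs d < delta)%R -> (Rabs (s * d) < delta)%R).
      { intros d Hd. rewrite Rabs_mult, (Rabs_pos_eq s) by lra. pose proof (Rabs_pos d). nra. }
      split.
      - change (Rabs (fst (gam s) - fst z0) < delta)%R.
        replace (fst (gam s) - fst z0)%R with (s * (fst z - fst z0))%R
          by (unfold gam, v; simpl; ring). now apply Hb.
      - change (Rabs (snd (gam s) - snd z0) < delta)%R.
        replace (snd (gam s) - snd z0)%R with (s * (snd z - snd z0))%R
          by (unfold gam, v; simpl; ring). now apply Hb. }
    destruct (Hchart _ Hin) as [E1 E2].
    assert (Hn : gam s <> 0) by (rewrite <- E1; apply Cexp_neq_0).
    assert (Hn' : 1 - gam s <> 0) by (rewrite <- E2; apply Cexp_neq_0).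
    assert (D0 : cder gam s v) by apply cder_line.
    assert (D0' : cder (fun t => 1 - gam t) s (- v)).
    { apply (cder_ext (fun t : R => (1 - z0) + RtoC t * (- v))); [|apply cder_line].
      intro t. unfold gam. ring. }
    assert (D1 : cder (fun t => fst (chart (gam t))) s (v / gam s)).
    { unfold chart, chart_log; cbn [fst snd].
      eapply cder_eq.
      - apply cder_plus; [apply cder_const|].
        apply (cder_Clog (fun t => gam t / Cexp (fst u0))); [exact (proj1 Hin)|].
        apply cder_mult; [exact D0|apply cder_const].
      - cbv beta. field. split; [exact Hn|apply Cexp_neq_0]. }
    assert (D2 : cder (fun t => snd (chart (gam t))) s (- v / (1 - gam s))).
    { unfold chart, chart_log; cbn [fst snd].
      eapply cder_eq.
      - apply cder_plus; [apply cder_const|].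
        apply (cder_Clog (fun t => (1 - gam t) / Cexp (snd u0))); [exact (proj2 Hin)|].
        apply cder_mult; [exact D0'|apply cder_const].
      - cbv beta. field. split; [exact Hn'|apply Cexp_neq_0]. }
    assert (D3 := cder_holo f _ s _ _ Hg D2).
    assert (D4 : cder (fun t => / phi (chart (gam t))) s
       (- / phi (chart (gam s)) * (Ci / RtoC (4 * PI) *
          (snd (chart (gam s)) * (v / gam s) + fst (chart (gam s)) * (v / (1 - gam s)))))).
    { assert (D := flat_section_transport tau0hat tau' phi u0 (gam s) v Htriv Hflat Hphi Hin).
      cbv zeta in D. fold (chart (gam s)) in D.
      (* [D] concerns the line restarted at [gam s] with parameter 0; the shift returns to the
         parameter of [gam]. *)
      replace 0%R with (s - s)%R in D by ring. apply cder_shift in D.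
      revert D. apply cder_ext. intro t. unfold chart. do 2 f_equal.
      replace (gam s + RtoC (t - s) * v) with (gam t) by (unfold gam; rewrite RtoC_minus; ring).
      reflexivity. }
    eapply cder_eq.
    - apply cder_mult; [exact D4|]. apply cder_Cexp.
      apply cder_mult; [|apply cder_const]. apply cder_plus; [exact D3|].
      apply cder_mult; [|apply cder_const]. apply cder_mult; [exact D1|exact D2].
    (* Up to the factor [1 / (2 pi i)] the logarithmic derivative has three terms:
       [(u2 du1 - u1 du2) / 2] from the inverse of [phi], [- u2 du1] from [f] because
       [e^{-u2} = 1 / (1 - z)], and [(u1 du2 + u2 du1) / 2] from the product. They cancel. *)
    - cbv beta. rewrite Cexp_opp, E2. set (u := chart (gam s)) in *.
      set (E := Cexp ((f _ + _) / _)). set (ph := / phi u).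
      rewrite Ci_4pi.
      field. repeat split; trivial.
      intro H. apply Hn. replace (gam s) with (- (1 - gam s - 1)) by ring. rewrite H. ring. }
  assert (HP2 : (0 < PI / 2)%R) by (pose proof PI_RGT_0; lra).
  assert (CE : continuous (fun u : C2_US => Cexp (fst u)) u0).
  { apply (continuous_Cexp (T := C2_US)). destruct u0; apply (@continuous_fst C_UniformSpace C_UniformSpace). }
  assert (L1 := CE _ (locally_ball z0 delta)). unfold filtermap in L1.
  generalize (filter_and _ _ L1 (locally_ball (T := C2_US) u0 (mkposreal _ HP2))).
  apply filter_imp. intros [w1 w2] [B1 [[_ B2] [_ B3]]] Hw.
  change (Rabs (snd w1 - snd (fst u0)) < PI / 2)%R in B2.
  change (Rabs (snd w2 - snd (snd u0)) < PI / 2)%R in B3.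
  cbn [fst] in B1.
  (* Closer than [PI / 2] to [u0] the branch returns the point itself, so a whole neighborhood of
     [u0] in the curve is parametrized by [z]. *)
  assert (Ew : chart (Cexp w1) = (w1, w2)).
  { unfold chart, chart_log; cbn [fst snd].
    replace (1 - Cexp w1) with (Cexp w2) by (rewrite <- (Mhat'_sub _ _ Hw); ring).
    apply Rabs_def2 in B2, B3.
    rewrite !add_Clog_Cexp; [reflexivity| |]; simpl; lra. }
  destruct (Hdelta _ B1) as [I1 G1].
  rewrite <- Ew, (HK _ I1 G1), (HG _ B1), <- Hc0.
  symmetry. apply HK; [exact Hin0|]. rewrite Hc0. exact (locally_singleton _ _ Hf).
Qed.

Theorem theorem4p36 (F : C -> C4pi2) (L : C * C -> C4pi2)
  (hF : dilog_continuation F) (hL : CS_function L) :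
  exists c : C4pi2, forall u1 u2 : C, Mhat' (u1, u2) ->
    L (u1, u2) =
      add4 (add4 (F u2) (to_C4pi2 (u1 * u2 / RtoC 2)%C)) c.
Proof.
  pose proof (loc_const_exp_ratio F L hF hL) as HK.
  set (d := fun u => repr (L u) - repr (F (snd u)) - fst u * snd u / RtoC 2).
  set (b := (base1, - (1)) : C * C).
  (* The constant is the difference of the two functions at the base point. *)
  exists (to_C4pi2 (d b)). intros u1 u2 Hu.
  pose proof (Mhat'_connected _ _ HK Hu) as E. fold b in E.
  unfold exp_ratio in E. fold (d b) (d (u1, u2)) in E.
  assert (E1 : Cexp ((d (u1, u2) - d b) / two_pi_i) = 1).
  { replace ((d (u1, u2) - d b) / two_pi_i) with (d (u1, u2) / two_pi_i - d b / two_pi_i)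
      by (field; apply two_pi_i_neq_0).
    rewrite Cexp_minus, E. field. apply Cexp_neq_0. }
  apply Cexp_eq_1 in E1. destruct E1 as [k Hk].
  assert (E2 : d (u1, u2) = d b + RtoC (4 * PI * PI * IZR (- k))).
  { rewrite four_pi2_two_pi_i, opp_IZR, RtoC_opp. fold two_pi_i in Hk.
    replace (d (u1, u2)) with (d b + two_pi_i * ((d (u1, u2) - d b) / two_pi_i))
      by (field; apply two_pi_i_neq_0).
    rewrite Hk. ring. }
  unfold add4.
  set (h := u1 * u2 / RtoC 2).
  (* Each representative taken by [add4] adds an unknown multiple of [4 pi^2]; all of them are
     absorbed in one shift together with [k]. *)
  destruct (repr_to_C4pi2 h) as [k1 ->].
  destruct (repr_to_C4pi2 (d b)) as [k2 ->].
  destruct (repr_to_C4pi2 (repr (F u2) + (h + RtoC (4 * PI * PI * IZR k1)))) as [k3 ->].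
  rewrite <- (cls_repr _ (L (u1, u2))). fold (to_C4pi2 (repr (L (u1, u2)))).
  replace (repr (L (u1, u2))) with (d (u1, u2) + repr (F u2) + h)
    by (unfold d, h; cbn [fst snd]; ring).
  rewrite E2, <- (to_C4pi2_shift _ (k1 + k2 + k3 + k)). f_equal.
  rewrite !plus_IZR, opp_IZR, !Rmult_plus_distr_l, <- Ropp_mult_distr_r, !RtoC_plus, RtoC_opp. ring.
Qed.
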